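(* Let $c\colon Q\to G$ be a continuous homomorphism of an $r$-discrete Hausdorff groupoid $Q$ into a discrete group $G$, and put $N=c^{-1}(e)$. Assume that $Q$ is amenable. Then the canonical map $i\colon C^*(N)\to C^*(Q)$ is faithful.
   Context: Groupoids are locally compact topological groupoids. A groupoid $Q$ is $r$-discrete if its range map $r$ is a local homeomorphism onto the unit space $Q^0$ (so counting measures on the sets $Q^u=r^{-1}(u)$ give a Haar system). Amenability of $Q$ is topological amenability in the sense of Renault and Anantharaman-Delaroche: there is a net $(g_i)$ of nonnegative functions in $C_c(Q)$ with $\sum_{x\in Q^u}g_i(x)\le 1$ for all $u\in Q^0$, $\sum_{x\in Q^u}g_i(x)\to1$ uniformly on compact subsets of $Q^0$, and $\sum_{y\in Q^{r(x)}}|g_i(x^{-1}y)-g_i(y)|\to0$ uniformly for $x$ in compact subsets of $Q$. $C_c(Q)$ is a $^*$-algebra with $(fg)(x)=\sum_{r(y)=r(x)}f(y)g(y^{-1}x)$ and $f^*(x)=\overline{f(x^{-1})}$, and $C^*(Q)$, the full groupoid $C^*$-algebra, is the enveloping $C^*$-algebra of $C_c(Q)$. With $e$ the identity of $G$, $N=c^{-1}(e)$ is an open $r$-discrete subgroupoid of $Q$, and $i\colon C^*(N)\to C^*(Q)$ is the homomorphism extending the inclusion (by zero) of $C_c(N)$ in $C_c(Q)$. *)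

(* Defs.v *)
From HB Require Import structures.
From mathcomp Require Import all_boot all_order all_algebra.
From mathcomp Require Import all_classical all_reals all_analysis.
From mathcomp Require Import complex sesquilinear.

Set Implicit Arguments.
Unset Strict Implicit.
Unset Printing Implicit Defensive.

Import Order.TTheory GRing.Theory Num.Theory.
Import numFieldNormedType.Exports.

Local Open Scope classical_set_scope.
Local Open Scope ring_scope.

(* Renault's axioms for a groupoid on the set Q. The product [gmul] is a total
   function, but only its values on composable pairs are constrained. *)
Record groupoid (Q : Type) := Groupoid {
  composable : Q -> Q -> Prop;
  gmul : Q -> Q -> Q;
  ginv : Q -> Q;
  ginvK : involutive ginv;
  gmulA : forall x y z, composable x y -> composable y z ->
    [/\ composable (gmul x y) z, composable x (gmul y z) &
        gmul (gmul x y) z = gmul x (gmul y z)];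
  composableVg : forall x, composable (ginv x) x;
  gmulKg : forall x y, composable x y -> gmul (ginv x) (gmul x y) = y;
  composablegV : forall x, composable x (ginv x);
  gmulgK : forall z x, composable z x -> gmul (gmul z x) (ginv x) = z
}.

Section Groupoids.
Variables (Q : Type) (g : groupoid Q).

Definition grange (x : Q) : Q := gmul g x (ginv g x).

Definition gunits : set Q := range grange.

Definition gfiber (u : Q) : set Q := [set x | grange x = u].

Definition grange_units (x : Q) : gunits :=
  exist _ (grange x) (mem_set (imageT grange x)).

End Groupoids.

Definition topological_groupoid (Q : topologicalType) (g : groupoid Q) : Prop :=
  continuous (ginv g) /\
  {within [set p : Q * Q | composable g p.1 p.2],
    continuous (fun p : Q * Q => gmul g p.1 p.2)}.

Definition local_homeomorphism (X Y : topologicalType) (f : X -> Y) : Prop :=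
  forall x, exists U : set X,
    [/\ open U, U x, open (f @` U), {within U, continuous f} &
        exists h : Y -> X,
          (forall z, U z -> h (f z) = z) /\ {within f @` U, continuous h}].

(* The unit space [gunits g : set Q], seen as a type, carries the topology
   induced by Q. *)
Definition r_discrete (Q : topologicalType) (g : groupoid Q) : Prop :=
  local_homeomorphism (grange_units g).

Definition groupoid_hom (Q : Type) (g : groupoid Q) (G : groupType)
    (c : Q -> G) : Prop :=
  forall x y, composable g x y -> c (gmul g x y) = (c x * c y)%g.

Section Kernel.
Variables (Q : Type) (g : groupoid Q) (G : groupType) (c : Q -> G).
Hypothesis hc : groupoid_hom g c.

Definition ghom_ker : set Q := [set x | c x = 1%g].

Definition ker_composable (x y : ghom_ker) : Prop :=
  composable g (val x) (val y).

(* [insubd x z] is z as an element of the kernel when z lies in it (which is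
   the case for products of composable pairs and for inverses), and x
   otherwise. *)
Definition ker_mul (x y : ghom_ker) : ghom_ker :=
  insubd x (gmul g (val x) (val y)).

Definition ker_inv (x : ghom_ker) : ghom_ker := insubd x (ginv g (val x)).

Let ker1 (x : ghom_ker) : c (val x) = 1%g.
Proof. exact: (set_mem (valP x)). Qed.

Let val_mul (x y : ghom_ker) :
  ker_composable x y -> val (ker_mul x y) = gmul g (val x) (val y).
Proof.
by move=> xy; apply/insubdK/mem_set; rewrite /ghom_ker /= hc// !ker1 mul1g.
Qed.

Let val_inv (x : ghom_ker) : val (ker_inv x) = ginv g (val x).
Proof.
apply/insubdK/mem_set => /=; rewrite /ghom_ker /=; set z := val x.
have [cmp _ _] := gmulA (composableVg g z) (composablegV g z).
have := hc cmp; rewrite (hc (composableVg g z)) ker1 mulg1.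
rewrite gmulgK; last exact: composableVg.
by move=> e; apply: (mulgI (c (ginv g z))); rewrite mulg1 -e.
Qed.

Let ker_invK : involutive ker_inv.
Proof. by move=> x; apply: val_inj; rewrite !val_inv ginvK. Qed.

Let ker_mulA (x y z : ghom_ker) : ker_composable x y -> ker_composable y z ->
  [/\ ker_composable (ker_mul x y) z, ker_composable x (ker_mul y z) &
      ker_mul (ker_mul x y) z = ker_mul x (ker_mul y z)].
Proof.
move=> xy yz; have [xy_z x_yz xyz] := gmulA xy yz.
have h1 : ker_composable (ker_mul x y) z by rewrite /ker_composable val_mul.
have h2 : ker_composable x (ker_mul y z) by rewrite /ker_composable val_mul.
by split => //; apply: val_inj; rewrite !val_mul.
Qed.

Let ker_composableVg (x : ghom_ker) : ker_composable (ker_inv x) x.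
Proof. by rewrite /ker_composable val_inv; exact: composableVg. Qed.

Let ker_composablegV (x : ghom_ker) : ker_composable x (ker_inv x).
Proof. by rewrite /ker_composable val_inv; exact: composablegV. Qed.

Let ker_mulKg (x y : ghom_ker) :
  ker_composable x y -> ker_mul (ker_inv x) (ker_mul x y) = y.
Proof.
move=> xy; have [_ h _] := ker_mulA (ker_composableVg x) xy.
by apply: val_inj; rewrite val_mul// val_inv val_mul// gmulKg.
Qed.

Let ker_mulgK (z x : ghom_ker) :
  ker_composable z x -> ker_mul (ker_mul z x) (ker_inv x) = z.
Proof.
move=> zx; have [h _ _] := ker_mulA zx (ker_composablegV x).
by apply: val_inj; rewrite val_mul// val_inv val_mul// gmulgK.
Qed.

Definition kernel_groupoid : groupoid ghom_ker :=
  Groupoid ker_invK ker_mulA ker_composableVg ker_mulKg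
           ker_composablegV ker_mulgK.

End Kernel.

Section ConvolutionAlgebra.
Variables (R : realType) (Q : topologicalType) (g : groupoid Q).
Implicit Types f h : Q -> R[i].

(* [R[i]^o] is [R[i]] with the topology of its norm. *)
Definition Cc : set (Q -> R[i]) :=
  [set f | continuous (f : Q -> R[i]^o) /\
           compact (closure [set x | f x != 0])].

(* [\sum_(y \in A)] is a sum with finite support: for f in Cc only finitely
   many points of a fiber of an r-discrete groupoid contribute. *)
Definition gconv f h : Q -> R[i] :=
  fun x => \sum_(y \in gfiber g (grange g x)) f y * h (gmul g (ginv g y) x).

Definition ginvol f : Q -> R[i] := fun x => (f (ginv g x))^*.

Definition uniform_net_cvg (I : Type) (le : I -> I -> Prop)
    (F : I -> Q -> R[i]) (l : R[i]) (K : set Q) : Prop :=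
  forall eps : R[i], 0 < eps ->
    exists i0, forall i, le i0 i -> forall x, K x -> `|F i x - l| < eps.

Definition directed (I : Type) (le : I -> I -> Prop) : Prop :=
  [/\ inhabited I, forall i, le i i,
      forall i j k, le i j -> le j k -> le i k &
      forall i j, exists k, le i k /\ le j k].

Definition topologically_amenable : Prop :=
  exists (I : Type) (le : I -> I -> Prop) (k : I -> Q -> R[i]),
    [/\ directed le,
        forall i, Cc (k i) /\ forall x, 0 <= k i x,
        forall i u, gunits g u -> \sum_(x \in gfiber g u) k i x <= 1,
        forall K, compact K -> K `<=` gunits g ->
          uniform_net_cvg le (fun i u => \sum_(x \in gfiber g u) k i x) 1 K &
        forall K, compact K ->
          uniform_net_cvg le
            (fun i x => \sum_(y \in gfiber g (grange g x))
                          `|k i (gmul g (ginv g x) y) - k i y|) 0 K].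

End ConvolutionAlgebra.

(* C*-algebras need not be unital. Norms take (nonnegative) values in R[i]. *)
Structure cstarAlgebra (R : realType) := CStarAlgebra {
  cs_sort :> completeNormedModType R[i];
  cs_mul : cs_sort -> cs_sort -> cs_sort;
  cs_star : cs_sort -> cs_sort;
  cs_mulA : associative cs_mul;
  cs_mull : forall a x y z, cs_mul (a *: x + y) z = a *: cs_mul x z + cs_mul y z;
  cs_mulr : forall a x y z, cs_mul z (a *: x + y) = a *: cs_mul z x + cs_mul z y;
  cs_starD : forall a x y, cs_star (a *: x + y) = a^* *: cs_star x + cs_star y;
  cs_starM : forall x y, cs_star (cs_mul x y) = cs_mul (cs_star y) (cs_star x);
  cs_starK : involutive cs_star;
  cs_normM : forall x y, `|cs_mul x y| <= `|x| * `|y|;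
  cs_normC : forall x, `|cs_mul (cs_star x) x| = `|x| ^+ 2
}.

Definition cstar_hom (R : realType) (A B : cstarAlgebra R) (phi : A -> B) :
    Prop :=
  [/\ linear phi,
      forall x y, phi (cs_mul x y) = cs_mul (phi x) (phi y) &
      forall x, phi (cs_star x) = cs_star (phi x)].

Structure hilbertSpace (R : realType) := HilbertSpace {
  hs_sort :> completeNormedModType R[i];
  hs_dot : {dot hs_sort for Num.conj};
  hs_norm : forall xi, `|xi| ^+ 2 = hs_dot xi xi
}.

Section GroupoidCStar.
Variables (R : realType) (Q : topologicalType) (g : groupoid Q).
Implicit Types f h : Q -> R[i].

Definition Cc_star_hom (A : cstarAlgebra R) (phi : (Q -> R[i]) -> A) : Prop :=
  [/\ forall a f h, Cc f -> Cc h ->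
        phi (fun x => a * f x + h x) = a *: phi f + phi h,
      forall f h, Cc f -> Cc h ->
        phi (gconv g f h) = cs_mul (phi f) (phi h) &
      forall f, Cc f -> phi (ginvol g f) = cs_star (phi f)].

(* *-representations of the *-algebra Cc by bounded operators. *)
Definition Cc_rep (H : hilbertSpace R) (rho : (Q -> R[i]) -> H -> H) : Prop :=
  [/\ forall f, Cc f ->
        linear (rho f) /\ exists M : R[i], forall xi, `|rho f xi| <= M * `|xi|,
      forall a f h, Cc f -> Cc h ->
        forall xi, rho (fun x => a * f x + h x) xi = a *: rho f xi + rho h xi,
      forall f h, Cc f -> Cc h ->
        forall xi, rho (gconv g f h) xi = rho f (rho h xi) &
      forall f, Cc f ->
        forall xi eta, hs_dot H (rho (ginvol g f) xi) eta = hs_dot H xi (rho f eta)].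

(* The enveloping C*-algebra of Cc: the Hausdorff completion of Cc for the
   seminorm f |-> sup_rho ||rho f||, rho ranging over the *-representations of Cc
   on Hilbert spaces. The operator norm is itself the supremum of ||rho f xi||
   over the unit ball, and both suprema are taken at once. *)
Structure groupoidCStar := GroupoidCStar {
  gcs_alg :> cstarAlgebra R;
  gcs_inj : (Q -> R[i]) -> gcs_alg;
  gcs_hom : Cc_star_hom gcs_inj;
  gcs_dense : dense (gcs_inj @` @Cc R Q);
  gcs_norm : forall f, Cc f ->
    supremums [set t | exists (H : hilbertSpace R) (rho : (Q -> R[i]) -> H -> H)
                              (xi : H),
                 [/\ Cc_rep rho, `|xi| <= 1 & t = `|rho f xi|]]
              `|gcs_inj f|
}.

End GroupoidCStar.

Definition extend0 (R : realType) (Q : Type) (N : set Q) (f : N -> R[i]) :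
    Q -> R[i] :=
  fun x => if insub x is Some u then f u else 0.

(* The homomorphism C*(N) -> C*(Q) extending the inclusion of Cc(N) in Cc(Q).
   Continuity is automatic for a *-homomorphism of C*-algebras; it is recorded
   because it is what makes the extension from the dense image of Cc(N)
   unique. *)
Definition canonical_map (R : realType) (Q : topologicalType) (g : groupoid Q)
    (N : set Q) (gN : groupoid N)
    (CN : groupoidCStar R gN) (CQ : groupoidCStar R g) (i : CN -> CQ) : Prop :=
  [/\ cstar_hom i, continuous i &
      forall f, Cc f -> i (gcs_inj CN f) = gcs_inj CQ (extend0 f)].

(* Main.v *)
Require Import Defs.
From HB Require Import structures.
From mathcomp Require Import all_boot all_order all_algebra.
From mathcomp Require Import all_classical all_reals all_analysis.
From mathcomp Require Import complex sesquilinear.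
From mathcomp Require Import ring lra.

Set Implicit Arguments.
Unset Strict Implicit.
Unset Printing Implicit Defensive.

Import Order.TTheory GRing.Theory Num.Theory.
Import numFieldNormedType.Exports.

Local Open Scope classical_set_scope.
Local Open Scope ring_scope.

(* A representation rho of C_c(N) on H, with a vector xi, defines the functional
   f |-> <rho (f|_N) xi, xi> on C_c(Q). It is positive on every f^* f: with functions p_k
   whose supports are source-injective and cover the support of f, the element
   sum_k p_k E(p_k^* f') is T f' for a function T > 0 on that support, where E is the
   restriction to N; choosing f' = f / sqrt T makes f^* f equal on N to
   sum_k (E h_k)^* h_k with h_k = p_k^* f'. The GNS construction then gives a representation
   of C_c(Q) containing the restriction of rho to C_c(N) xi, so that
   |rho a (rho e xi)| <= |i a| |rho e xi| for a, e in C_c(N). Taking e = a^* yields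
   |rho a| <= |i a|, hence i is isometric on a dense subalgebra. *)

(** The norm of C*(N) is a supremum over all representations of C_c(N), so each [rho] must be
    dominated by a representation of C_c(Q). The obstacle is positivity: [f] may be spread over all
    values of [c], so the restriction of f^* f to N is not visibly a square in C_c(N).
    Source-injectivity makes the sum over k act on f' as multiplication by a scalar function: T at x
    is the sum of |p_k(z)|^2 over the z with the same range and the same value of [c] as x. For x in
    N, y^-1 x and y^-1 share range and value of [c], so T agrees at both and its square root passes
    from one factor of f^* f to the other. The other difficulty is that a positive functional on
    C_c(Q), which has neither a complete norm nor in general a unit, does not by itself give bounded
    operators. Boundedness is first proved for functions supported in an open set on which range and
    source are injective, and such functions span C_c(Q). *)

Lemma normc_le (R : realType) (z : R[i]) :
  `|z| <= (`|complex.Re z| + `|complex.Im z|)%:C%C.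
Proof.
case: z => a b; rewrite [Complex a b]complexE (le_trans (ler_normD _ _))//=.
rewrite normrM !normc_def /= !expr0n !expr1n /= !addr0 add0r !sqrtr_sqr.
by rewrite sqrtr1 !mul1r !mul0r !subr0 !addr0 !add0r -rmorphD.
Qed.

(** Real and imaginary parts are 1-Lipschitz, so both components are Cauchy in [R]. These limits
    supply the inner product of the completion and the pointwise limits of functionals. *)
Lemma complex_cauchy_cvg (R : realType) (F : set_system R[i]^o) :
  ProperFilter F -> cauchy F -> exists l : R[i]^o, F --> l.
Proof.
move=> FF /cauchyP Fc.
pose re (z : R[i]^o) : R := complex.Re z.
pose im (z : R[i]^o) : R := complex.Im z.
have reB (x y : R[i]^o) e : `|x - y| < e%:C%C -> `|re x - re y| < e.
  move=> h; rewrite -ltcR; apply: le_lt_trans h.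
  by rewrite (le_trans _ (normc_ge_Re _))//; case: (x) (y) => ? ? [? ?].
have imB (x y : R[i]^o) e : `|x - y| < e%:C%C -> `|im x - im y| < e.
  move=> h; rewrite -ltcR; apply: le_lt_trans h.
  have := normc_ge_Re ((x - y) * 'i%C); rewrite ReiNIm normrN normrM.
  have -> : `|'i%C : R[i]| = 1 by rewrite normc_def /= expr0n expr1n add0r sqrtr1.
  by rewrite mulr1; apply: le_trans; case: (x) (y) => ? ? [? ?].
have rec : cauchy (re @ F).
  apply/cauchyP => e e0.
  have [x Fx] := Fc e%:C%C ltac:(by rewrite (ltcR 0 e)).
  exists (re x); move: Fx; rewrite -!ball_normE => Fx; apply: (@filterS _ F _ _ _ _ Fx) => y; exact: reB.
have imc : cauchy (im @ F).
  apply/cauchyP => e e0.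
  have [x Fx] := Fc e%:C%C ltac:(by rewrite (ltcR 0 e)).
  exists (im x); move: Fx; rewrite -!ball_normE => Fx; apply: (@filterS _ F _ _ _ _ Fx) => y; exact: imB.
have /cvg_ex [a ha] := R_complete (fmap_proper_filter re FF) rec.
have /cvg_ex [b hb] := R_complete (fmap_proper_filter im FF) imc.
exists (Complex a b : R[i]^o).
apply/cvgrPdist_lt => e e0.
have e0' : 0 < complex.Re e / 2 by move: e0; rewrite ltcE /= => /andP[_]; lra.
have eE : e = (complex.Re e)%:C%C by rewrite RRe_real// ger0_real// ltW.
move/cvgrPdist_lt/(_ _ e0') : ha => ha.
move/cvgrPdist_lt/(_ _ e0') : hb => hb.
near=> z.
have h1 : `|a - re z| < complex.Re e / 2 by near: z.
have h2 : `|b - im z| < complex.Re e / 2 by near: z.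
rewrite (le_lt_trans (normc_le _))// eE ltcR.
by move: h1 h2; rewrite /re /im; case: (z) => ? ? /= ? ?; lra.
Unshelve. all: by end_near. Qed.

Lemma le_lim0 (R : realType) (x y C : R[i]) : 0 <= C ->
  (forall e, 0 < e -> x <= y + C * e) -> x <= y.
Proof.
move=> C0 h; apply/ler_addgt0Pr => e e0.
(* [C + 1] instead of [C] keeps the quotient meaningful when [C] is 0. *)
have C1 : 0 < C + 1 by rewrite ltr_wpDl.
apply: le_trans (h (e / (C + 1)) _) _; first by rewrite divr_gt0.
by rewrite lerD2l mulrCA; apply: ler_piMr; rewrite ?(ltW e0)// ler_pdivrMr// mul1r lerDl.
Qed.

Lemma eq_lim0 (R : realType) (x y C : R[i]) : 0 <= C ->
  (forall e, 0 < e -> `|x - y| <= C * e) -> x = y.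
Proof.
move=> C0 h; apply/eqP; rewrite -subr_eq0 -normr_le0.
by apply: (le_lim0 C0) => e e0; rewrite add0r h.
Qed.

Lemma gt0_common (R : realType) (d e : R[i]) : 0 < d -> 0 < e ->
  exists f, [/\ 0 < f, f <= d & f <= e].
Proof.
(* The order on [R[i]] is partial; half the harmonic mean is a lower bound that needs no comparison
   of [d] with [e]. *)
move=> d0 e0; exists (d * e / (d + e)); have de : 0 < d + e by rewrite addr_gt0.
split; first by rewrite divr_gt0// mulr_gt0.
  by rewrite ler_pdivrMr// ler_pM2l// lerDr ltW.
by rewrite ler_pdivrMr// mulrC ler_pM2l// lerDl ltW.
Qed.

(** * Hilbert space completion of a semi-inner product *)

Record semi_inner (R : realType) (V : lmodType R[i]) := SemiInner {
  sdot :> V -> V -> R[i];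
  sdotP : forall a x y z, sdot (a *: x + y) z = a * sdot x z + sdot y z;
  sdotC : forall x y, sdot y x = (sdot x y)^*;
  sdot_ge0 : forall x, 0 <= sdot x x }.

Section SemiInner.
Variables (R : realType) (V : lmodType R[i]) (s : semi_inner V).
Implicit Types (x y z : V) (a : R[i]).

Definition snorm x := sqrtC (s x x).

Lemma snorm_ge0 x : 0 <= snorm x.
Proof. by rewrite sqrtC_ge0 sdot_ge0. Qed.

Lemma snormK x : snorm x ^+ 2 = s x x.
Proof. exact: sqrtCK. Qed.

Lemma sdot0l z : s 0 z = 0.
Proof.
have := sdotP s 1 0 0 z; rewrite scale1r add0r mul1r => /eqP.
by rewrite -[X in X == _]add0r (inj_eq (addIr _)) eq_sym => /eqP.
Qed.

Lemma sdotDl x y z : s (x + y) z = s x z + s y z.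
Proof. by rewrite -[x in LHS]scale1r sdotP mul1r. Qed.

Lemma sdotZl a x z : s (a *: x) z = a * s x z.
Proof. by rewrite -[_ *: _]addr0 sdotP sdot0l addr0. Qed.

Lemma sdotNl x z : s (- x) z = - s x z.
Proof. by rewrite -scaleN1r sdotZl mulN1r. Qed.

Lemma sdotBl x y z : s (x - y) z = s x z - s y z.
Proof. by rewrite sdotDl sdotNl. Qed.

Lemma sdotPr a x y z : s z (a *: x + y) = a^* * s z x + s z y.
Proof. by rewrite sdotC sdotP rmorphD rmorphM /= -!sdotC. Qed.

Lemma sdotZr a x z : s z (a *: x) = a^* * s z x.
Proof. by rewrite sdotC sdotZl rmorphM /= -sdotC. Qed.

Lemma sdotDr x y z : s z (x + y) = s z x + s z y.
Proof. by rewrite sdotC sdotDl rmorphD /= -!sdotC. Qed.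

Lemma sdotBr x y z : s z (x - y) = s z x - s z y.
Proof. by rewrite sdotC sdotBl rmorphB /= -!sdotC. Qed.

Lemma sdot_CauchySchwarz x y : `|s x y| <= snorm x * snorm y.
Proof.
rewrite -(ler_pXn2r (ltn0Sn 1)) ?nnegrE ?mulr_ge0 ?snorm_ge0//.
rewrite exprMn !snormK; apply: (le_lim0 (sdot_ge0 s x)) => e e0.
(* Adding [e] to [s y y] covers a null vector [y]: the expanded square of [d *: x - c *: y] can be
   divided by [d], and [e] tends to 0 through [le_lim0]. *)
set c := s x y; pose d := s y y + e.
have d0 : 0 < d by rewrite ltr_wpDl// sdot_ge0.
have dR : d^* = d by apply/CrealP; rewrite realE ltW.
have := sdot_ge0 s (d *: x - c *: y).
have -> : s (d *: x - c *: y) (d *: x - c *: y) =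
    d * (d * s x x - `|c| ^+ 2) - e * `|c| ^+ 2.
  rewrite sdotBl !sdotBr !sdotZl !sdotZr (sdotC s x y) -/c dR normCK /d; ring.
rewrite subr_ge0 => h.
have : 0 <= d * (d * s x x - `|c| ^+ 2).
  by apply: le_trans h; rewrite mulr_ge0// ?ltW// exprn_ge0.
by rewrite pmulr_rge0// subr_ge0 mulrDl mulrC (mulrC e).
Qed.

Lemma snormZ a x : snorm (a *: x) = `|a| * snorm x.
Proof.
apply/eqP; rewrite -(@eqrXn2 _ 2)// ?mulr_ge0 ?snorm_ge0//.
by rewrite exprMn !snormK sdotZl sdotZr mulrA normCK.
Qed.

Lemma snormD x y : snorm (x + y) <= snorm x + snorm y.
Proof.
rewrite -(ler_pXn2r (ltn0Sn 1)) ?nnegrE ?addr_ge0 ?snorm_ge0//.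
have -> : snorm (x + y) ^+ 2 = s x x + s y y + (s x y + (s x y)^*).
  by rewrite snormK sdotDl !sdotDr (sdotC s x y); ring.
rewrite sqrrD !snormK [leRHS]addrAC lerD2l.
have c0 : s x y + (s x y)^* \is Num.real.
  by apply/CrealP; rewrite rmorphD /= conjCK addrC.
rewrite (le_trans (real_ler_norm c0))// (le_trans (ler_normD _ _))//.
by rewrite norm_conjC -mulr2n lerMn2r sdot_CauchySchwarz orbT.
Qed.

Lemma snorm_le x d : 0 <= d -> `|s x x| <= d * snorm x -> snorm x <= d.
Proof.
move=> d0; rewrite -snormK normrX ger0_norm ?snorm_ge0// expr2.
have [->//|x0] := eqVneq (snorm x) 0.
by rewrite ler_pM2r// lt_def x0 snorm_ge0.
Qed.

End SemiInner.

Section Completion.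
Variables (R : realType) (V : lmodType R[i]) (s : semi_inner V).
Implicit Types (F G : V -> R[i]^o) (u v w : V) (d e M N : R[i]).

(** The distance in the dual norm from [G] to the functional of [u] is at most [d]; the pointwise
    form avoids a supremum. *)
Definition near_functional G d u := forall v, `|G v - s u v| <= d * snorm s v.

Definition bounded_functional F M := forall v, `|F v| <= M * snorm s v.

(* [sdot s u] is antilinear: the completion is the closure of the [sdot s u] among the
   bounded antilinear functionals. *)
Definition completion_set : set (V -> R[i]^o) :=
  [set F | (forall a u v, F (a *: u + v) = a^* * F u + F v) /\
           forall d, 0 < d -> exists u, near_functional F d u].

Definition completion_pred : {pred (V -> R[i]^o)} := mem completion_set.

Lemma near_functional_le G d e u :
  d <= e -> near_functional G d u -> near_functional G e u.
Proof.
by move=> de h v; apply: le_trans (h v) _; rewrite ler_wpM2r// snorm_ge0.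
Qed.

(** Testing both approximations on [u - w] itself bounds its square by [d + e] times its
    seminorm. *)
Lemma near_functional_dist G d e u w : 0 <= d -> 0 <= e ->
  near_functional G d u -> near_functional G e w -> snorm s (u - w) <= d + e.
Proof.
move=> d0 e0 h1 h2; apply: snorm_le; first by rewrite addr_ge0.
set v := u - w; rewrite {1}/v sdotBl mulrDl.
have -> : s u v - s w v = (G v - s w v) - (G v - s u v) by ring.
by rewrite (le_trans (ler_normB _ _))// addrC lerD// ?h1 ?h2.
Qed.

Lemma completion_closed : GRing.submod_closed completion_pred.
Proof.
split; first apply/mem_set; first split.
- by move=> a u v; rewrite mulr0 addr0.
- by move=> d d0; exists 0 => v; rewrite sdot0l subr0 normr0 mulr_ge0 ?snorm_ge0 ?ltW.
move=> a F G /set_mem[F1 F2] /set_mem[G1 G2]; apply/mem_set; split.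
  move=> b u v; rewrite /= !fctE F1 G1; rewrite /GRing.scale /=; ring.
move=> d d0; have a1 : 0 < `|a| + 1 by rewrite ltr_wpDl.
have d1 : 0 < d / (`|a| + 1) by rewrite divr_gt0.
have [u Fu] := F2 _ d1; have [w Gw] := G2 _ d1.
exists (a *: u + w) => v; rewrite sdotP !fctE.
have -> : a *: F v + G v - (a * s u v + s w v) =
  a * (F v - s u v) + (G v - s w v) by rewrite /GRing.scale /=; ring.
rewrite (le_trans (ler_normD _ _))// normrM.
have -> : d = `|a| * (d / (`|a| + 1)) + d / (`|a| + 1).
  by rewrite -[X in _ + X]mul1r -mulrDl mulrCA divff ?mulr1// gt_eqF.
by rewrite mulrDl lerD// -mulrA ler_wpM2l.
Qed.

HB.instance Definition _ :=
  GRing.isSubmodClosed.Build _ _ completion_pred completion_closed.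

Record completion := Completion {
  cfun :> V -> R[i]^o; cfunP : cfun \in completion_pred }.

HB.instance Definition _ := [isSub for cfun].
HB.instance Definition _ := [Choice of completion by <:].
HB.instance Definition _ := [SubChoice_isSubLmodule of completion by <:].

Lemma cfun_linear (F : completion) a u v : F (a *: u + v) = a^* * F u + F v.
Proof. by have /set_mem[] := cfunP F. Qed.

Lemma cfun_near (F : completion) d : 0 < d -> exists u, near_functional F d u.
Proof. by have /set_mem[_] := cfunP F; apply. Qed.

Lemma cfun_inj (F G : completion) : (forall v, F v = G v) -> F = G.
Proof. by move=> h; apply: val_inj; apply/funext. Qed.

Lemma cfunD a (F G : completion) v : (a *: F + G) v = a * F v + G v.
Proof. by []. Qed.

Lemma cfunN (F : completion) v : (- F) v = - F v.
Proof. by []. Qed.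

Lemma cfunDE (F G : completion) v : (F + G) v = F v + G v.
Proof. by []. Qed.

Lemma cfunB (F : completion) u v : F (u - v) = F u - F v.
Proof.
have := cfun_linear F (-1) v u; rewrite scaleN1r addrC => ->.
by rewrite rmorphN rmorph1 mulN1r addrC.
Qed.

Lemma near_bounded G d u : 0 <= d -> near_functional G d u ->
  bounded_functional G (snorm s u + d).
Proof.
move=> d0 h v; rewrite -[G v](subrK (s u v)) (le_trans (ler_normD _ _))// addrC.
by rewrite mulrDl lerD// sdot_CauchySchwarz.
Qed.

Lemma completion_bounded (F : completion) :
  exists2 M, 0 <= M & bounded_functional F M.
Proof.
have [u h] := cfun_near F ltr01; exists (snorm s u + 1).
  by rewrite addr_ge0// snorm_ge0.
exact: near_bounded h.
Qed.

Lemma bounded_near_dist (F : completion) M G d e u w :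
  0 <= M -> 0 <= d -> 0 <= e -> bounded_functional F M ->
  near_functional G d u -> near_functional G e w ->
  `|F u - F w| <= M * (d + e).
Proof.
move=> M0 d0 e0 FM h1 h2; rewrite -cfunB (le_trans (FM _))//.
by rewrite ler_wpM2l// (near_functional_dist _ _ h1 h2).
Qed.

(* F u tends to the inner product of F and G when the functional of u tends to G. *)
Definition dot_spec F G (l : R[i]) := forall M d u, 0 <= M -> 0 <= d ->
  bounded_functional F M -> near_functional G d u -> `|F u - l| <= M * d.

(** The values [F u], for [u] approximating [G], generate a Cauchy filter because [F] is bounded. *)
Lemma dot_ex (F G : completion) : exists l, dot_spec F G l.
Proof.
have [M M0 FM] := completion_bounded F.
pose B d : set R[i]^o := [set F u | u in near_functional G d].
pose FF := filter_from [set d : R[i] | 0 < d] B.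
have FFF : ProperFilter FF.
  apply: filter_from_proper; last first.
    by move=> d /= d0; have [u hu] := cfun_near G d0; exists (F u), u.
  apply: filter_from_filter; first by exists 1 => /=.
  move=> d e /= /gt0_common/[apply] -[f [f0 fd fe]]; exists f => // _ [u hu <-].
  by split; exists u => //; apply: near_functional_le hu.
have FFc : cauchy FF.
  apply/cauchyP => e e0; have M1 : 0 < M + M + 1 by rewrite ltr_wpDl// addr_ge0.
  have d0 : 0 < e / (M + M + 1) by rewrite divr_gt0.
  have [u hu] := cfun_near G d0; exists (F u); eexists; first exact: d0.
  move=> _ [w hw <-]; rewrite -ball_normE /=.
  apply: le_lt_trans (bounded_near_dist M0 (ltW d0) (ltW d0) FM hu hw) _.
  rewrite mulrDr -mulrDl mulrCA gtr_pMr// ltr_pdivrMr// mul1r ltrDl//.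
have [l hl] := complex_cauchy_cvg FFF FFc; exists l => N d u N0 d0 FN hu.
(* The rate is claimed for any bound [N] of [F], not only for [M]. In a comparison of [u] with a
   finer approximant [w], [N] pays for the precision of [w] and 1 for the distance from [F w] to the
   limit. *)
apply: (@le_lim0 _ _ _ (N + 1)); first by rewrite addr_ge0.
move=> e e0; have [f /= f0 hf] := hl _ (nbhsx_ballx l e e0).
rewrite -ball_normE in hf; have [f' [f'0 f'f f'e]] := gt0_common f0 e0.
have [w hw] := cfun_near G f'0.
have /= wl := hf (F w) (ex_intro2 _ _ w (near_functional_le f'f hw) erefl).
rewrite -(subrK (F w) (F u)) -addrA (le_trans (ler_normD _ _))//.
rewrite mulrDl addrA lerD//; last by rewrite mul1r distrC ltW.
apply: le_trans (bounded_near_dist N0 d0 (ltW f'0) FN hu hw) _.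
by rewrite mulrDr lerD2l ler_wpM2l.
Qed.

Definition cdot (F G : completion) : R[i] := sval (cid (dot_ex F G)).

Lemma cdotP (F G : completion) : dot_spec F G (cdot F G).
Proof. exact: (svalP (cid (dot_ex F G))). Qed.

Lemma cdot_near (F G : completion) d M u : 0 <= M -> 0 <= d ->
  bounded_functional F M -> near_functional G d u ->
  `|F u - cdot F G| <= M * d.
Proof. exact: cdotP. Qed.

Lemma cdot_linear a (F G H : completion) :
  cdot (a *: F + G) H = a * cdot F H + cdot G H.
Proof.
have [M M0 FM] := completion_bounded F.
have [N N0 GN] := completion_bounded G.
have [P P0 FP] := completion_bounded (a *: F + G).
apply: (@eq_lim0 _ _ _ (P + (`|a| * M + N))).
  by rewrite !addr_ge0// mulr_ge0.
move=> e e0; have [u hu] := cfun_near H e0.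
have e1 := ltW e0.
have -> : cdot (a *: F + G) H - (a * cdot F H + cdot G H) =
  (a * (F u - cdot F H) + (G u - cdot G H)) -
  ((a *: F + G) u - cdot (a *: F + G) H) by rewrite cfunD; ring.
rewrite (le_trans (ler_normB _ _))// addrC mulrDl lerD ?cdot_near//.
rewrite (le_trans (ler_normD _ _))// mulrDl lerD ?cdot_near//.
by rewrite normrM -mulrA ler_wpM2l ?cdot_near.
Qed.

Lemma cdotC (F G : completion) : cdot G F = (cdot F G)^*.
Proof.
have [M M0 FM] := completion_bounded F.
have [N N0 GN] := completion_bounded G.
have [u1 hu1] := cfun_near F ltr01.
have [w1 hw1] := cfun_near G ltr01.
(* One bound for both approximants: at precision at most 1, each is within 2 of the fixed [u1] or
   [w1]. *)
pose B := snorm s u1 + snorm s w1 + 2 + 2.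
have B0 : 0 <= B by rewrite !addr_ge0 ?snorm_ge0.
have S0 : 0 <= M + N + B + B := addr_ge0 (addr_ge0 (addr_ge0 M0 N0) B0) B0.
apply: (eq_lim0 S0).
move=> d0 d00; have [e [e0 ed e1]] := gt0_common d00 (@ltr01 R[i]).
apply: (@le_trans _ _ ((M + N + B + B) * e)); last by rewrite ler_wpM2l.
have le1 := ltW e0.
have [u hu] := cfun_near F e0; have [w hw] := cfun_near G e0.
have nu : snorm s u <= B.
  rewrite -(subrK u1 u) (le_trans (snormD _ _ _))//.
  have := near_functional_dist le1 ler01 hu hu1 => h.
  rewrite addrC /B -addrA -addrA lerD2l (le_trans h)//.
  by rewrite (le_trans (_ : _ <= 2))// ?lerD2r// addrA lerDr addr_ge0 ?snorm_ge0.
have nw : snorm s w <= B.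
  rewrite -(subrK w1 w) (le_trans (snormD _ _ _))//.
  have := near_functional_dist le1 ler01 hw hw1 => h.
  rewrite addrC /B [X in _ <= X + 2 + 2]addrC -addrA -addrA lerD2l (le_trans h)//.
  by rewrite (le_trans (_ : _ <= 2))// ?lerD2r// addrA lerDr addr_ge0 ?snorm_ge0.
(* [F w] and [G u] approximate the two inner products, and are close to [s u w] and [s w u], which
   are conjugate. *)
have -> : cdot G F - (cdot F G)^* = (F w - cdot F G)^* - (G u - cdot G F)
   + (G u - s w u) - (F w - s u w)^*.
  by rewrite !rmorphB /= -(sdotC s u w); ring.
rewrite (le_trans (ler_normB _ _))// mulrDl lerD//; last first.
  rewrite norm_conjC (le_trans (hu w))// mulrC ler_wpM2r//.
rewrite (le_trans (ler_normD _ _))// mulrDl lerD//; last first.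
  rewrite (le_trans (hw u))// mulrC ler_wpM2r//.
rewrite (le_trans (ler_normB _ _))// mulrDl lerD//.
  by rewrite norm_conjC cdot_near.
by rewrite cdot_near.
Qed.

Lemma snorm_near_le (F : completion) M d u : 0 <= M -> 0 <= d ->
  bounded_functional F M -> near_functional F d u -> snorm s u <= M + d.
Proof.
move=> M0 d0 FM h; apply: snorm_le; first exact: addr_ge0.
have -> : s u u = F u - (F u - s u u) by ring.
by rewrite (le_trans (ler_normB _ _))// mulrDl lerD.
Qed.

Lemma cdot_ge0 (F : completion) : 0 <= cdot F F.
Proof.
have [M M0 FM] := completion_bounded F.
(* The order of [R[i]] only compares numbers with real difference, so reality comes first. *)
have zR : cdot F F \is Num.real by apply/CrealP; rewrite -cdotC.
have C0 : 0 <= M + 1 + M by rewrite !addr_ge0.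
apply: (le_lim0 C0) => d d0; have [e [e0 ed e1]] := gt0_common d0 (@ltr01 R[i]).
apply: (@le_trans _ _ (cdot F F + (M + 1 + M) * e)); last first.
  by rewrite lerD2l ler_wpM2l.
have le1 := ltW e0; have [u hu] := cfun_near F e0.
rewrite (le_trans (sdot_ge0 s u))// -lerBlDl.
have rR : s u u - cdot F F \is Num.real.
  by rewrite realB// realE sdot_ge0.
rewrite (le_trans (real_ler_norm rR))//.
have -> : s u u - cdot F F = (F u - cdot F F) - (F u - s u u) by ring.
rewrite (le_trans (ler_normB _ _))// addrC mulrDl lerD ?cdot_near//.
rewrite (le_trans (hu u))// mulrC ler_wpM2r//.
by rewrite (le_trans (snorm_near_le M0 le1 FM hu))// lerD2l.
Qed.

Definition cdot_semi_inner := SemiInner cdot_linear cdotC cdot_ge0.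

Lemma embed_subproof u : (s u : V -> R[i]^o) \in completion_pred.
Proof.
apply/mem_set; split=> [a v w|d d0]; first exact: sdotPr.
by exists u => v; rewrite subrr normr0 mulr_ge0 ?snorm_ge0 ?ltW.
Qed.

Definition embed u := Completion (embed_subproof u).

(** The vector [u] approximates [embed u] with error 0, so the rate in [dot_spec] becomes an
    equality. *)
Lemma cdot_embed (F : completion) u : cdot F (embed u) = F u.
Proof.
have [M M0 FM] := completion_bounded F.
apply/esym/eqP; rewrite -subr_eq0 -normr_le0 -(mulr0 M).
by apply: cdot_near => // v; rewrite /= subrr normr0 mul0r.
Qed.

Definition cnorm (F : completion) := snorm cdot_semi_inner F.

Lemma cnorm_bounded (F : completion) : bounded_functional F (cnorm F).
Proof.
move=> u; rewrite -cdot_embed.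
have := sdot_CauchySchwarz cdot_semi_inner F (embed u) => /= /le_trans; apply.
by rewrite {2}/snorm /= cdot_embed /=.
Qed.

(** With [cnorm_bounded] this identifies the Hilbert norm with the dual norm, so later norm
    estimates are made by evaluating functionals. *)
Lemma cnorm_le (F : completion) M : 0 <= M -> bounded_functional F M ->
  cnorm F <= M.
Proof.
move=> M0 FM; rewrite -(ler_pXn2r (ltn0Sn 1)) ?nnegrE ?snorm_ge0//.
rewrite snormK /=; apply: (@le_lim0 _ _ _ (M + M)); first exact: addr_ge0.
move=> e e0; have le0 := ltW e0; have [u hu] := cfun_near F e0.
rewrite -[leLHS]ger0_norm ?cdot_ge0//.
have -> : cdot F F = F u - (F u - cdot F F) by ring.
rewrite (le_trans (ler_normB _ _))// mulrDl addrA lerD ?cdot_near//.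
rewrite (le_trans (FM u))// expr2 -mulrDr ler_wpM2l//.
exact: snorm_near_le hu.
Qed.

Lemma cnorm_eq0 (F : completion) : cnorm F = 0 -> F = 0.
Proof.
move=> F0; apply: cfun_inj => v; have := cnorm_bounded F v.
by rewrite F0 mul0r normr_le0 => /eqP.
Qed.

HB.instance Definition _ := Lmodule_isNormed.Build R[i] completion
  (snormD cdot_semi_inner) (snormZ cdot_semi_inner) cnorm_eq0.

(** The limit is taken pointwise, evaluation at [v] being Lipschitz with constant [snorm s v]. *)
Lemma completion_complete (FF : set_system completion) :
  ProperFilter FF -> cauchy FF -> cvg FF.
Proof.
move=> FFF /cauchyP FFc.
have FFd d : 0 < d -> exists F0 : completion, FF [set F : completion | `|F0 - F| < d].
  by move=> d0; have [F0] := FFc _ d0; rewrite -ball_normE; exists F0.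
have evB (F G : completion) v : `|F v - G v| <= `|F - G| * snorm s v.
  by have := cnorm_bounded (F - G) v; rewrite cfunDE cfunN.
have Lex v : exists l : R[i]^o, (fun F : completion => F v) @ FF --> l.
  apply: complex_cauchy_cvg; apply/cauchyP => e e0.
  have n1 : 0 < snorm s v + 1 by rewrite ltr_wpDl// snorm_ge0.
  have [|F0 hF0] := FFd (e / (snorm s v + 1)); first by rewrite divr_gt0.
  exists (F0 v); rewrite -ball_normE; apply: (@filterS _ FF _ _ _ _ hF0) => F /= h.
  rewrite (le_lt_trans (evB _ _ _))//.
  apply: le_lt_trans (_ : e / (snorm s v + 1) * snorm s v < e).
    by rewrite ler_wpM2r ?snorm_ge0// ltW.
  rewrite -mulrA gtr_pMr// mulrC ltr_pdivrMr// mul1r ltrDl//.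
have [L hL] := choice Lex.
have nearL e v : 0 < e -> FF [set F : completion | `|L v - F v| < e].
  by move=> e0; have := hL v _ (nbhsx_ballx (L v) e e0); rewrite -ball_normE.
(* The estimate passes to the limit at each [v] with [e] independent of [v]. It yields both
   approximating vectors for [L] and convergence in norm. *)
have distL e (F0 : completion) v : FF [set F : completion | `|F0 - F| < e] ->
    `|L v - F0 v| <= e * snorm s v.
  move=> h; apply: (@le_lim0 _ _ _ 1) => // e' e'0.
  have [F [/= h1 h2]] := filter_ex (filterI h (nearL e' v e'0)).
  rewrite -(subrK (F v) (L v)) -addrA (le_trans (ler_normD _ _))//.
  rewrite [leRHS]addrC mul1r lerD ?(ltW h2)//.
  by rewrite distrC (le_trans (evB _ _ _))// ler_wpM2r ?snorm_ge0// ltW.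
have LP : L \in completion_pred.
  apply/mem_set; split=> [a u v|d d0].
    apply: (@eq_lim0 _ _ _ (1 + `|a| + 1)); first by rewrite !addr_ge0.
    move=> e e0.
    have [F [[/= h1 h2] /= h3]] := filter_ex
      (filterI (filterI (nearL e (a *: u + v) e0) (nearL e u e0)) (nearL e v e0)).
    have -> : L (a *: u + v) - (a^* * L u + L v) = (L (a *: u + v) - F (a *: u + v))
        - a^* * (L u - F u) - (L v - F v) by rewrite cfun_linear; ring.
    rewrite (le_trans (ler_normB _ _))// mulrDl mul1r lerD ?(ltW h3)//.
    rewrite (le_trans (ler_normB _ _))// mulrDl mul1r lerD ?(ltW h1)//.
    by rewrite normrM norm_conjC ler_wpM2l// ltW.
  have d2 : 0 < d / 2 by rewrite divr_gt0.
  have [F0 hF0] := FFd _ d2; have [u hu] := cfun_near F0 d2.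
  exists u => v; rewrite -(subrK (F0 v) (L v)) -addrA (le_trans (ler_normD _ _))//.
  by rewrite [d]splitr mulrDl lerD// distL.
apply/cvg_ex; exists (Completion LP); apply/cvgrPdist_le => e e0.
have e2 : 0 < e / 2 by rewrite divr_gt0.
have [F0 hF0] := FFd _ e2; apply: filterS (hF0) => F /= hF.
rewrite -(subrK F0 (Completion LP)) -addrA (le_trans (ler_normD _ _))//.
rewrite [e]splitr lerD//; last exact: ltW.
apply: cnorm_le; first exact: ltW.
by move=> v; rewrite cfunDE cfunN; exact: (distL _ F0 _ hF0).
Qed.

HB.instance Definition _ := Uniform_isComplete.Build completion completion_complete.

Lemma cdot_bilinear : bilinear_for *%R (Num.conj \; *%R) cdot.
Proof.
split=> [F a G K|F a G K]; first exact: cdot_linear.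
exact: (sdotPr cdot_semi_inner).
Qed.

HB.instance Definition _ := bilinear_isBilinear.Build R[i] completion completion
  R[i] *%R (Num.conj \; *%R) cdot cdot_bilinear.

Lemma cdot_hermitian (F G : completion) :
  cdot F G = (-1) ^+ false * (cdot G F)^*.
Proof. by rewrite mul1r -cdotC. Qed.

HB.instance Definition _ := isHermitianSesquilinear.Build R[i] completion
  false Num.conj cdot cdot_hermitian.

Lemma cdot_gt0 (F : completion) : F != 0 -> 0 < cdot F F.
Proof.
move=> F0; rewrite lt_def cdot_ge0 andbT; apply: contra F0 => /eqP h.
by apply/eqP/cnorm_eq0; rewrite /cnorm /snorm /= h sqrtC0.
Qed.

HB.instance Definition _ := isDotProduct.Build R[i] completion cdot cdot_gt0.

Lemma cdot_normE (F : completion) : `|F| ^+ 2 = cdot F F.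
Proof. exact: snormK. Qed.

Definition hilbert_completion : hilbertSpace R :=
  @HilbertSpace R completion cdot cdot_normE.

End Completion.

Section CompletionOperator.
Variables (R : realType) (V : lmodType R[i]) (s : semi_inner V).
Implicit Types (F G : completion s) (u v : V).

(* The extension to the completion of the operator whose adjoint on V is T, acting on
   functionals by precomposition with T. *)
Definition completion_op (T : V -> V) F : completion s :=
  insubd (0 : completion s) (F \o T : V -> R[i]^o).

Variables (S T : V -> V) (C D : R[i]).
Hypothesis S_linear : linear S.
Hypothesis T_linear : linear T.
Hypothesis adjST : forall u v, s (S u) v = s u (T v).
Hypothesis C_ge0 : 0 <= C.
Hypothesis D_ge0 : 0 <= D.
Hypothesis S_bounded : forall v, snorm s (S v) <= D * snorm s v.
Hypothesis T_bounded : forall v, snorm s (T v) <= C * snorm s v.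

Lemma near_functional_comp G d u : 0 <= d -> near_functional s G d u ->
  near_functional s (G \o T) (C * d) (S u).
Proof.
move=> d0 h v; rewrite adjST /= (le_trans (h _))// -mulrA mulrCA ler_wpM2l//.
Qed.

Lemma completion_opE F v : completion_op T F v = F (T v).
Proof.
rewrite /completion_op -[X in X v]/(val _) insubdK//; apply/mem_set; split.
  by move=> a u w; rewrite /= T_linear cfun_linear.
move=> d d0; have C1 : 0 < C + 1 by rewrite ltr_wpDl.
have dC : 0 < d / (C + 1) by rewrite divr_gt0.
have [u hu] := cfun_near F dC; exists (S u).
apply: near_functional_le (near_functional_comp (ltW dC) hu).
by rewrite mulrCA ger_pMr// ler_pdivrMr// mul1r lerDl.
Qed.

Lemma completion_op_linear : linear (completion_op T).
Proof.
move=> a F G; apply: cfun_inj => v.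
by rewrite completion_opE !cfunD !completion_opE.
Qed.

Lemma completion_op_norm F : `|completion_op T F| <= C * `|F|.
Proof.
apply: cnorm_le; first by rewrite mulr_ge0.
move=> v; rewrite completion_opE (le_trans (cnorm_bounded _ _))//.
by rewrite -mulrA mulrCA ler_wpM2l //; exact: snorm_ge0.
Qed.

End CompletionOperator.

(** For [u] approximating [G], the number [F (S u)] approximates both sides: it is the value of
    [completion_op S F] at [u], and [S u] approximates [G \o T] by [near_functional_comp]. *)
Lemma completion_op_adj (R : realType) (V : lmodType R[i]) (s : semi_inner V)
    (S T : V -> V) (C D : R[i]) (F G : completion s) :
  linear S -> linear T -> (forall u v, s (S u) v = s u (T v)) ->
  0 <= C -> 0 <= D ->
  (forall v, snorm s (S v) <= D * snorm s v) ->
  (forall v, snorm s (T v) <= C * snorm s v) ->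
  cdot (completion_op S F) G = cdot F (completion_op T G).
Proof.
move=> lS lT adj C0 D0 bS bT.
have adj' u v : s (T u) v = s u (S v).
  by rewrite sdotC -adj -sdotC.
have [M M0 FM] := completion_bounded F.
have [M' M'0 FM'] := completion_bounded (completion_op S F).
apply: (@eq_lim0 _ _ _ (M' + M * C)); first by rewrite addr_ge0 ?mulr_ge0.
move=> e e0; have le0 := ltW e0; have [u hu] := cfun_near G e0.
have -> : cdot (completion_op S F) G - cdot F (completion_op T G) =
  (F (S u) - cdot F (completion_op T G)) -
  (completion_op S F u - cdot (completion_op S F) G).
  by rewrite (completion_opE lS adj' D0 bS); ring.
rewrite (le_trans (ler_normB _ _))// addrC mulrDl; apply: lerD.
  exact: cdot_near.
rewrite -mulrA; apply: cdot_near => //; first exact: mulr_ge0.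
move=> v; rewrite (completion_opE lT adj C0 bT).
exact: (near_functional_comp adj bT le0 hu v).
Qed.

(** * Compactly supported functions on a locally compact space *)

(** The near-covering form of compactness is applied to the filter of lists containing a given list:
    near each point, all large enough lists cover. *)
Lemma compact_finite_cover (X : topologicalType) (T : eqType) (K : set X)
    (W : T -> set X) :
  compact K -> (forall x, K x -> exists t, nbhs x (W t)) ->
  exists l : seq T, forall x, K x -> exists2 t, t \in l & W t x.
Proof.
move=> /compact_near_coveringP Kc KW.
pose F := filter_from [set: seq T] (fun l => [set l' : seq T | {subset l <= l'}]).
have FF : ProperFilter F.
  apply: filter_from_proper; last by move=> l _; exists l => x.
  apply: filter_from_filter; first by exists [::].
  move=> l l' _ _; exists (l ++ l') => // k /= h.
  by split=> x xl; apply: h; rewrite mem_cat xl ?orbT.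
have [|l _ hl] := Kc _ F (fun l x => exists2 t, t \in l & W t x) _ _.
  move=> x /KW[t xt]; exists (W t, [set l : seq T | {subset [:: t] <= l}]) => /=.
    by split => //; exists [:: t].
  by move=> [y l] /= [yt tl]; exists t => //; apply: tl; rewrite inE.
by exists l => x; apply: (hl l) => //= y.
Qed.

Section Bumps.
Variables (R : realType) (X : topologicalType).
Hypothesis hlc : locally_compact [set: X].
Hypothesis hT2 : hausdorff_space X.

Lemma bump_function (x : X) (O : set X) : open O -> O x ->
  exists f : X -> R, [/\ continuous f, forall y, 0 <= f y, f x = 1,
    compact (closure [set y | f y != 0]) & closure [set y | f y != 0] `<=` O].
Proof.
move=> Oo Ox; have [V] := hlc (x := x) I; rewrite withinET => Vx [Vc Vcl].
have Vr := compact_regular hT2 Vc Vx.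
have /Vr[B Bx BVO] : nbhs x (V `&` O).
  by apply: filterI => //; exact: open_nbhs_nbhs.
(* Separating [x] from the complement of the interior of [B], whose closure lies in [V] and in [O],
   keeps the closed support of [1 - f] inside both. *)
have Cc : closed (~` B°) by apply: open_closedC; exact: open_interior.
have nC : ~ (~` B°) x by rewrite /= notK.
have := @locally_compact_completely_regular X R hlc hT2 x _ Cc nC.
move=> /(@uniform_separatorP _ R) [f [fc f01 fx fC]].
have f1 y : f y <= 1 by have /= := f01 _ (imageT f y); rewrite in_itv /= => /andP[].
have sf : [set y | 1 - f y != 0] `<=` B.
  move=> y /= fy; apply: interior_subset; apply: contrapT => yB.
  by move: fy; rewrite (fC (f y)) ?subrr ?eqxx//; exists y.
have scl := closure_subset sf.
exists (fun y => 1 - f y); split => //.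
- by move=> y; apply: continuousB; [exact: cst_continuous|exact: fc].
- by move=> y; rewrite subr_ge0.
- by rewrite (fx (f x)) ?subr0//; exists x.
- apply: (@subclosed_compact X _ V); [exact: closed_closure|exact: Vc|].
  by move=> y /scl/BVO[].
- by move=> y /scl/BVO[].
Qed.

Lemma bump_cover (K : set X) (P : set (set X)) : compact K ->
  (forall x, K x -> exists2 U, P U & open U /\ U x) ->
  exists s : seq (X -> R), [/\
    forall f, f \in s -> continuous f /\ forall y, 0 <= f y,
    forall f, f \in s -> exists2 U, P U & closure [set y | f y != 0] `<=` U,
    forall f, f \in s -> compact (closure [set y | f y != 0]) &
    forall x, K x -> 1 <= \sum_(f <- s) f x].
Proof.
move=> Kc KP.
have ex x : exists f : X -> R, K x -> [/\ continuous f /\ forall y, 0 <= f y, f x = 1,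
    compact (closure [set y | f y != 0]) &
    exists2 U, P U & closure [set y | f y != 0] `<=` U].
  have [Kx|nKx] := pselect (K x); last by exists (fun=> 0).
  have [U PU [Uo Ux]] := KP x Kx.
  by have [f [fc f0 fx fK fU]] := bump_function Uo Ux; exists f => _; split => //; exists U.
have [f hf] := choice ex.
have [|l hl] := @compact_finite_cover _ X K
    (fun x => [set y | K x /\ 2^-1 < f x y]) Kc.
  move=> x Kx; exists x; have [[fc _] fx _ _] := hf x Kx.
  have : \forall y \near x, 2^-1 < f x y.
    by apply: (cvgr_gt _ (fc x)); rewrite fx invf_lt1// ltr1n.
  by apply: filterS.
(* The cover consists of the sets where [f x] exceeds 1/2; the factor 2 brings the sum up to 1. *)
exists [seq (fun y => 2 * f x y) | x <- l & x \in K].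
have supp x : [set y | 2 * f x y != 0] = [set y | f x y != 0].
  by apply/seteqP; split=> y /=; rewrite mulf_eq0 pnatr_eq0.
split.
- move=> f0 /mapP[x]; rewrite mem_filter => /andP[/set_mem Kx _] ->.
  have [[fc f_ge0] _ _ _] := hf x Kx; split=> y; last by rewrite mulr_ge0.
  by apply: cvgM; [exact: cvg_cst|exact: fc].
- move=> f0 /mapP[x]; rewrite mem_filter => /andP[/set_mem Kx _] ->.
  by rewrite supp; have [] := hf x Kx.
- move=> f0 /mapP[x]; rewrite mem_filter => /andP[/set_mem Kx _] ->.
  by rewrite supp; have [] := hf x Kx.
move=> y /hl[x xl [Kx fxy]]; rewrite big_map.
have xs : x \in [seq x <- l | x \in K] by rewrite mem_filter xl andbT mem_set.
rewrite (big_rem _ xs) /= -[1]addr0 lerD//.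
  by move: fxy => /ltW; lra.
rewrite big_seq sumr_ge0// => z /mem_rem; rewrite mem_filter => /andP[/set_mem Kz _].
by have [[_ f0] _ _ _] := hf z Kz; rewrite mulr_ge0.
Qed.

End Bumps.

Section ComplexContinuity.
Variables (R : realType) (X : topologicalType).

Lemma normc_real (x : R) : `|x%:C%C : R[i]| = `|x|%:C%C.
Proof. by rewrite normc_def /= expr0n addr0 sqrtr_sqr. Qed.

Lemma continuous_real_complex (f : X -> R) x : {for x, continuous f} ->
  {for x, continuous (fun y => (f y)%:C%C : R[i]^o)}.
Proof.
move=> fc; apply/cvgrPdist_lt => e e0.
have e0' : 0 < complex.Re e by move: e0; rewrite ltcE /= => /andP[_].
have eE : e = (complex.Re e)%:C%C by rewrite RRe_real// ger0_real// ltW.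
move/cvgrPdist_lt : fc => /(_ _ e0'); apply: filterS => y /= h.
by rewrite -rmorphB /= normc_real eE ltcR.
Qed.

Lemma continuous_Re (f : X -> R[i]^o) x : {for x, continuous f} ->
  {for x, continuous (fun y => complex.Re (f y) : R)}.
Proof.
move=> fc; apply/cvgrPdist_lt => e e0.
have e0' : 0 < e%:C%C :> R[i] by rewrite (ltcR 0 e).
move/cvgrPdist_lt : fc => /(_ _ e0'); apply: filterS => y /= h.
rewrite -ltcR; apply: le_lt_trans h; apply: le_trans (normc_ge_Re _).
by case: (f x) (f y) => ? ? [? ?].
Qed.

Lemma continuous_conj (f : X -> R[i]^o) x : {for x, continuous f} ->
  {for x, continuous (fun y => (f y)^* : R[i]^o)}.
Proof.
move=> fc; apply/cvgrPdist_lt => e e0.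
move/cvgrPdist_lt : fc => /(_ _ e0); apply: filterS => y /= h.
by rewrite -rmorphB norm_conjC.
Qed.

End ComplexContinuity.

Section CompactSupport.
Variables (R : realType) (X : topologicalType).
Implicit Types f h m : X -> R[i].

Lemma Cc_closed_sub (K : set X) f : closed K -> continuous (f : X -> R[i]^o) ->
  compact K -> (forall x, f x != 0 -> K x) -> Cc f.
Proof.
move=> Kcl fc Kc fK; split => //.
apply: (@subclosed_compact X _ K) => //; first exact: closed_closure.
by rewrite [X in _ `<=` X](closure_id K).1//; apply: closure_subset => x /fK.
Qed.

Lemma Cc_sub (K : set X) f : hausdorff_space X -> continuous (f : X -> R[i]^o) ->
  compact K -> (forall x, f x != 0 -> K x) -> Cc f.
Proof. by move=> hT2 fc Kc; apply: Cc_closed_sub => //; exact: compact_closed. Qed.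

Lemma Cc_supp f x : f x != 0 -> closure [set x | f x != 0] x.
Proof. by move=> fx; exact: subset_closure. Qed.

Lemma Cc0 : Cc (fun _ : X => 0 : R[i]).
Proof.
apply: (@Cc_closed_sub set0) => //; [exact: closed0|exact: cst_continuous|exact: compact0|].
by move=> x /=; rewrite eqxx.
Qed.

Lemma Cc_linear a f h : Cc f -> Cc h -> Cc (fun x => a * f x + h x).
Proof.
move=> [fc fK] [hc hK].
apply: (@Cc_closed_sub (closure [set x | f x != 0] `|` closure [set x | h x != 0])).
- by apply: closedU; exact: closed_closure.
- move=> x; apply: (@cvgD _ R[i]^o); last exact: hc.
  by apply: (@cvgM R[i]); [exact: cvg_cst|exact: fc].
- exact: compactU.
move=> x; have [fx|fx _] := eqVneq (f x) 0; last by left; exact: Cc_supp.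
by rewrite fx mulr0 add0r => hx; right; exact: Cc_supp.
Qed.

Lemma CcD f h : Cc f -> Cc h -> Cc (fun x => f x + h x).
Proof.
move=> fc hc; have := Cc_linear 1 fc hc.
by congr Cc; apply/funext => x; rewrite mul1r.
Qed.

Lemma CcM m f : continuous (m : X -> R[i]^o) -> Cc f -> Cc (fun x => m x * f x).
Proof.
move=> mc [fc fK].
apply: (@Cc_closed_sub (closure [set x | f x != 0])).
- exact: closed_closure.
- by move=> x; apply: (@cvgM R[i]); [exact: mc|exact: fc].
- exact: fK.
by move=> x fx; apply: Cc_supp; apply: contra fx => /eqP ->; rewrite mulr0.
Qed.

Lemma Cc_bounded f : Cc f -> exists2 M, 0 <= M & forall x, `|f x| <= M.
Proof.
move=> [fc fK].
have [|l hl] := @compact_finite_cover X X _ (fun x => [set y | `|f y| <= `|f x| + 1]) fK.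
  move=> x _; exists x; have /cvgrPdist_lt/(_ _ ltr01) := fc x; apply: filterS => y /= h.
  by rewrite -[f y](subrK (f x)) (le_trans (ler_normD _ _))// addrC lerD2l distrC ltW.
exists (\sum_(x <- l) (`|f x| + 1)); first by rewrite sumr_ge0// => x _; rewrite addr_ge0.
move=> x; have [->|fx] := eqVneq (f x) 0.
  by rewrite normr0 sumr_ge0// => y _; rewrite addr_ge0.
have [y yl /= xy] := hl x (Cc_supp fx); apply: le_trans xy _.
rewrite (big_rem _ yl) /= lerDl sumr_ge0// => z _; rewrite addr_ge0//.
Qed.

Hypothesis hlc : locally_compact [set: X].
Hypothesis hT2 : hausdorff_space X.

(** A property stable under sums need only be checked on functions supported in one member of [B].
    With bisections for [B] this gives finiteness on fibres, continuity of convolutions and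
    boundedness of left multiplications. *)
Lemma Cc_ind (B : set (set X)) (P : (X -> R[i]) -> Prop) :
  (forall x, exists2 U, B U & open U /\ U x) ->
  P (fun=> 0) -> (forall f h, Cc f -> Cc h -> P f -> P h -> P (fun x => f x + h x)) ->
  (forall f U, Cc f -> B U -> closure [set x | f x != 0] `<=` U -> P f) ->
  forall f, Cc f -> P f.
Proof.
move=> HB P0 PD PB f fC; have [fc fK] := fC.
have [s [sc sB sK s1]] := bump_cover R hlc hT2 fK (fun x _ => HB x).
(* The sum is at least 1 on the support of [f], so the maximum changes nothing there and keeps the
   denominator positive everywhere. *)
pose S x := Num.max (\sum_(g <- s) g x) 1.
have S0 x : 0 < S x by rewrite lt_max ltr01 orbT.
have sumc (t : seq (X -> R)) : {subset t <= s} -> continuous (fun x => \sum_(g <- t) g x).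
  elim: t => [|g t IH] ts x; first by under eq_fun do rewrite big_nil; exact: cvg_cst.
  under eq_fun do rewrite big_cons.
  apply: cvgD; first by apply: (sc g _).1; apply: ts; rewrite mem_head.
  by apply: IH => k kt; apply: ts; rewrite inE kt orbT.
have Sc : continuous (fun x => (S x)^-1).
  move=> x; apply: cvgV; first by rewrite gt_eqF.
  by apply: continuous_max; [exact: sumc|exact: cvg_cst].
pose part (g : X -> R) x : R[i] := (g x * (S x)^-1)%:C%C * f x.
have partC g : g \in s -> Cc (part g).
  move=> gs; apply: CcM fC => x; apply: (@continuous_real_complex _ _ (fun y => g y * (S y)^-1)).
  by apply: cvgM; [exact: (sc g gs).1|exact: Sc].
have Psum (t : seq (X -> R)) : {subset t <= s} ->
    Cc (fun x => \sum_(g <- t) part g x) /\ P (fun x => \sum_(g <- t) part g x).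
  elim: t => [|g t IH] ts.
    by under eq_fun do rewrite big_nil; split; [exact: Cc0|exact: P0].
  have gs : g \in s by apply: ts; rewrite mem_head.
  have [|tC tP] := IH; first by move=> k kt; apply: ts; rewrite inE kt orbT.
  under eq_fun do rewrite big_cons; split; first exact: CcD (partC _ gs) tC.
  apply: PD (partC _ gs) tC _ tP.
  have [U BU gU] := sB g gs; apply: PB (partC _ gs) BU _.
  apply: subset_trans gU; apply: closure_subset => x /=; apply: contra => /eqP gx.
  by rewrite /part gx mul0r mul0r.
have -> : f = (fun x => \sum_(g <- s) part g x); last exact: (Psum s _).2.
apply/funext => x; rewrite /part -mulr_suml.
have [->|fx] := eqVneq (f x) 0; first by rewrite mulr0.
rewrite -rmorph_sum /= -mulr_suml.
have := s1 x (Cc_supp fx) => h; rewrite /S max_l// divff ?mul1r// gt_eqF//.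
exact: lt_le_trans h.
Qed.

End CompactSupport.

(** * The convolution algebra of a groupoid *)

Section GroupoidAlgebra.
Variables (Q : Type) (g : groupoid Q).
Implicit Types x y z : Q.

Local Notation "x ⊙ y" := (gmul g x y) (at level 40, left associativity).
Local Notation "x ^†" := (ginv g x) (at level 2, format "x ^†").
Local Notation r := (grange g).

Lemma grange_inv x : r x^† = x^† ⊙ x.
Proof. by rewrite /grange ginvK. Qed.

Lemma gmulV_id x : composable g x (x^† ⊙ x) /\ x ⊙ (x^† ⊙ x) = x.
Proof.
have [_ c _] := gmulA (composablegV g x) (composableVg g x); split => //.
by have := gmulKg (composableVg g x); rewrite ginvK.
Qed.

Lemma gmul_id x : composable g (r x) x /\ r x ⊙ x = x.
Proof.
have [c _ _] := gmulA (composablegV g x) (composableVg g x); split => //.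
by have := gmulgK (composablegV g x); rewrite ginvK.
Qed.

(** Sources and units are not primitive in the axioms; this recovers composability as equality of
    the source of [x], which is the range of its inverse, with the range of [y]. *)
Lemma composableP x y : composable g x y <-> r x^† = r y.
Proof.
split=> [xy|]; last first.
  rewrite grange_inv => e; have [c1 e1] := gmulV_id x.
  have [c2 e2] := gmul_id y; rewrite -e in c2.
  by have [h _ _] := gmulA c1 c2; rewrite e1 in h.
(* The product of [p] and [q] is computed in two ways: absorbing [p] into [y] gives [q], absorbing
   [q] into [x] gives [p]. *)
rewrite grange_inv [r y]/grange; set p := _ ⊙ x; set q := y ⊙ _.
have [py _ e1] := gmulA (composableVg g x) xy; rewrite gmulKg// -/p in e1.
rewrite -/p in py.
have [_ pq e2] := gmulA py (composablegV g y); rewrite e1 -/q in e2.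
have [_ xq e3] := gmulA xy (composablegV g y); rewrite gmulgK// -/q in e3.
have [_ _ e4] := gmulA (composableVg g x) xq; rewrite -e3 -/p in e4.
exact: (etrans (esym e4) (esym e2)).
Qed.

Lemma composableVr x y : r y = r x -> composable g y^† x.
Proof. by move=> e; apply/composableP; rewrite ginvK. Qed.

Lemma grange_mul x y : composable g x y -> r (x ⊙ y) = r x.
Proof.
move=> xy; have [_ h _] := gmulA (composableVg g x) xy.
by move/composableP: h; rewrite ginvK.
Qed.

Lemma ginvM x y : composable g x y -> (x ⊙ y)^† = y^† ⊙ x^†.
Proof.
move=> xy; have e1 := gmulgK xy.
have [c1 _ _] := gmulA xy (composablegV g y).
have e2 := gmulKg c1; rewrite e1 in e2.
have [_ c2 _] := gmulA (composableVg g (x ⊙ y)) c1.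
rewrite e1 in c2; have := gmulgK c2; by rewrite e2.
Qed.

Lemma grange_divl x y : r y = r x -> r (y^† ⊙ x) = r y^†.
Proof. by move=> e; rewrite grange_mul//; exact: composableVr. Qed.

Lemma gmulVK x y : r y = r x -> y ⊙ (y^† ⊙ x) = x.
Proof. by move=> e; have := gmulKg (composableVr e); rewrite ginvK. Qed.

Lemma ginv_div x y : r y = r x -> (y^† ⊙ x)^† = x^† ⊙ y.
Proof. by move=> e; rewrite ginvM ?ginvK//; exact: composableVr. Qed.

Lemma gdiv_mul x z w : r z = r x -> r w = r z^† ->
  (z ⊙ w)^† ⊙ x = w^† ⊙ (z^† ⊙ x).
Proof.
move=> zx wz; have zw : composable g z w by apply/composableP.
rewrite ginvM//.
have wz' : composable g w^† z^† by apply/composableP; rewrite ginvK.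
by have [_ _] := gmulA wz' (composableVr zx).
Qed.

Lemma gdiv_inv x y : r y = r x -> y^† ⊙ x ⊙ x^† = y^†.
Proof. by move=> e; rewrite gmulgK//; exact: composableVr. Qed.

Lemma gmul_fiber_bij z : set_bij (gfiber g (r z^†)) (gfiber g (r z)) (gmul g z).
Proof.
have C w : gfiber g (r z^†) w -> composable g z w by move=> e; apply/composableP.
split.
- by move=> w /C zw; rewrite /gfiber /= grange_mul.
- move=> w w' /set_mem/C zw /set_mem/C zw' e.
  by rewrite -(gmulKg zw) e gmulKg.
move=> y zy; exists (z^† ⊙ y); last by rewrite gmulVK.
by rewrite /gfiber /= grange_divl.
Qed.

End GroupoidAlgebra.

(** Conjugation preserves the support, so the identity also covers infinite supports, where both
    sums are 0 by convention. *)
Lemma fsum_conj (R : realType) (I : choiceType) (D : set I) (F : I -> R[i]) :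
  (\sum_(i \in D) F i)^* = \sum_(i \in D) (F i)^*.
Proof.
rewrite rmorph_sum /= /finite_support !unlock.
suff -> : D `&` F @^-1` [set~ 0] = D `&` (fun i => (F i)^*) @^-1` [set~ 0] by [].
apply/seteqP; split=> i [Di] /= h; split=> //= e; apply: h; last by rewrite e conjC0.
by apply/eqP; rewrite -conjC_eq0; apply/eqP.
Qed.

Section Convolution.
Variables (R : realType) (Q : topologicalType) (g : groupoid Q).
Implicit Types (x y z : Q) (f h k : Q -> R[i]).

Local Notation "x ⊙ y" := (gmul g x y) (at level 40, left associativity).
Local Notation "x ^†" := (ginv g x) (at level 2, format "x ^†").
Local Notation r := (grange g).

Definition fiber_finite f := forall u, finite_set (gfiber g u `&` [set y | f y != 0]).

(** This is left invariance of the counting Haar system: translation by [z] is a bijection of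
    fibres. *)
Lemma fsum_fiber z (F : Q -> R[i]) : \sum_(y \in gfiber g (r z)) F y =
  \sum_(w \in gfiber g (r z^†)) F (z ⊙ w).
Proof.
exact: (@reindex_fsbig _ _ _ Q Q (gmul g z) _ _ F (gmul_fiber_bij g z)).
Qed.

(** A sum of infinite support is 0 by convention, so additivity needs one finite set carrying both
    terms; [f] provides it. *)
Lemma fsum_fiberD u (F1 F2 : Q -> R[i]) f : fiber_finite f ->
  (forall y, f y = 0 -> F1 y = 0) -> (forall y, f y = 0 -> F2 y = 0) ->
  \sum_(y \in gfiber g u) (F1 y + F2 y) =
  \sum_(y \in gfiber g u) F1 y + \sum_(y \in gfiber g u) F2 y.
Proof.
move=> fin h1 h2; pose A := gfiber g u `&` [set y | f y != 0].
have W (F : Q -> R[i]) : (forall y, f y = 0 -> F y = 0) ->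
    \sum_(y \in gfiber g u) F y = \sum_(y \in A) F y.
  move=> hF; apply/esym/fsbig_widen; first by move=> y [].
  by move=> y [uy] /= /not_andP[//|/negP]; rewrite negbK => /eqP /hF.
rewrite !W// ?fsbig_split//; first exact: fin.
by move=> y fy; rewrite h1// h2// addr0.
Qed.

Lemma gconvPl a f h k x : fiber_finite f -> fiber_finite h ->
  gconv g (fun y => a * f y + h y) k x = a * gconv g f k x + gconv g h k x.
Proof.
move=> ff fh; rewrite /gconv mulr_fsumr.
have fin : fiber_finite (fun y => `|f y| + `|h y|).
  move=> u; apply: (@sub_finite_set _ _ ((gfiber g u `&` [set y | f y != 0]) `|`
    (gfiber g u `&` [set y | h y != 0]))); last by rewrite finite_setU.
  move=> y [uy] /= fh0; have [fy|fy] := eqVneq (f y) 0; last by left.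
  by right; split => //=; apply: contra fh0 => /eqP ->; rewrite fy normr0 addr0.
have E y : `|f y| + `|h y| = 0 -> f y = 0 /\ h y = 0.
  by move=> /eqP; rewrite paddr_eq0// !normr_eq0 => /andP[/eqP ? /eqP ?].
rewrite -(@fsum_fiberD _ _ _ _ fin).
- by apply: eq_fsbigr => y _; ring.
- by move=> y /E[-> _]; rewrite mul0r mulr0.
- by move=> y /E[_ ->]; rewrite mul0r.
Qed.

Lemma gconvPr a f h k x : fiber_finite f ->
  gconv g f (fun y => a * h y + k y) x = a * gconv g f h x + gconv g f k x.
Proof.
move=> ff; rewrite /gconv mulr_fsumr -(@fsum_fiberD _ _ _ _ ff).
- by apply: eq_fsbigr => y _; ring.
- by move=> y ->; rewrite mul0r mulr0.
- by move=> y ->; rewrite mul0r.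
Qed.

Lemma gconvA f h k x : fiber_finite f -> fiber_finite h ->
  gconv g (gconv g f h) k x = gconv g f (gconv g h k) x.
Proof.
move=> ff fh; rewrite /gconv.
pose A := gfiber g (r x) `&` [set y | f y != 0].
have Afin : finite_set A by exact: ff.
(* [B] contains every [y] at which some term [f z * h (z^-1 y)] with [z] in [A] is nonzero. On the
   finite sets [A] and [B] the two sums can be exchanged. *)
pose B := \bigcup_(z in A) ((gmul g z) @` (gfiber g (r z^†) `&` [set y | h y != 0])).
have Bfin : finite_set B.
  by apply: bigcup_finite => // z _; apply: finite_image; exact: fh.
have AF y : ~ A y -> gfiber g (r x) y -> f y = 0.
  by move=> nA uy; apply/eqP; apply: contrapT => /negP fy; apply: nA.
have Bx : B `<=` gfiber g (r x).
  move=> _ [z [zx _] [w [wz _] <-]]; rewrite /gfiber /= grange_mul//.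
  by apply/composableP.
have BF y z : A z -> ~ B y -> gfiber g (r x) y -> h (z^† ⊙ y) = 0.
  move=> Az nB yx; apply/eqP; apply: contrapT => /negP hy; apply: nB.
  have zy : r z = r y by rewrite yx; case: Az.
  exists z => //; exists (z^† ⊙ y); last by rewrite gmulVK.
  by split => //; rewrite /gfiber /= grange_divl.
have inner y : gfiber g (r x) y -> \sum_(z \in gfiber g (r y)) f z * h (z^† ⊙ y) =
    \sum_(z \in A) f z * h (z^† ⊙ y).
  move=> yx; rewrite [r y]yx; apply/esym/fsbig_widen; first by move=> z [].
  by move=> z [zx nA] /=; rewrite (AF z)// mul0r.
transitivity (\sum_(y \in B) \sum_(z \in A) f z * h (z^† ⊙ y) * k (y^† ⊙ x)).
  transitivity (\sum_(y \in B) (\sum_(z \in gfiber g (r y)) f z * h (z^† ⊙ y)) * k (y^† ⊙ x)).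
    apply/esym/fsbig_widen => // y [yx nB] /=.
    rewrite inner// fsbig1 ?mul0r// => z Az; by rewrite (BF y z)// mulr0.
  apply: eq_fsbigr => y /set_mem/Bx yx; rewrite inner//.
  by rewrite mulr_fsuml.
rewrite exchange_fsbig//.
transitivity (\sum_(z \in A) f z *
  (\sum_(y \in gfiber g (r (z^† ⊙ x))) h y * k (y^† ⊙ (z^† ⊙ x)))); last first.
  apply: fsbig_widen; first by move=> z [].
  by move=> z [zx nA] /=; rewrite (AF z)// mul0r.
apply: eq_fsbigr => z /set_mem Az; have zx : r z = r x by case: Az.
transitivity (f z * \sum_(y \in gfiber g (r x)) h (z^† ⊙ y) * k (y^† ⊙ x)).
  rewrite mulr_fsumr; transitivity (\sum_(y \in B) f z * (h (z^† ⊙ y) * k (y^† ⊙ x))).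
    by apply: eq_fsbigr => y _; rewrite mulrA.
  apply: fsbig_widen => // y [yx nB] /=; by rewrite (BF y z)// mul0r mulr0.
congr (_ * _); rewrite -zx fsum_fiber grange_divl//.
apply: eq_fsbigr => w /set_mem wz.
by rewrite gmulKg ?gdiv_mul//; apply/composableP.
Qed.

Lemma ginvolK f : ginvol g (ginvol g f) = f.
Proof. by apply/funext => x; rewrite /ginvol ginvK conjCK. Qed.

Lemma ginvol_gconv f h x :
  ginvol g (gconv g f h) x = gconv g (ginvol g h) (ginvol g f) x.
Proof.
rewrite /ginvol /gconv fsum_conj.
rewrite fsum_fiber ginvK.
apply: eq_fsbigr => y /set_mem yx.
have cx : composable g x^† y by apply/composableP; rewrite ginvK.
have yx' : r y = r x by [].
by rewrite rmorphM mulrC ginvM// ginvK gdiv_inv// ginv_div.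
Qed.

Lemma ginvol_fun_linear a f h :
  ginvol g (fun x => a * f x + h x) = fun x => a^* * ginvol g f x + ginvol g h x.
Proof. by apply/funext => x; rewrite /ginvol rmorphD rmorphM. Qed.

Definition source_injective f :=
  forall y z, f y != 0 -> f z != 0 -> r y^† = r z^† -> y = z.

(* For phi supported on a set where the source map is injective, the sum over w defining
   (phi^* * f)(z^-1 v) reduces to w = z^-1. *)
Lemma gconv_source_injective phi m f x : source_injective phi ->
  gconv g phi (fun y => m y * gconv g (ginvol g phi) f y) x =
  gconv g (fun y => `|phi y| ^+ 2) m x * f x.
Proof.
move=> inj; rewrite /gconv mulr_fsuml; apply: eq_fsbigr => z /set_mem zx.
have [->|pz] := eqVneq (phi z) 0; first by rewrite normr0 expr0n !mul0r.
rewrite grange_divl//.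
have -> : \sum_(y \in gfiber g (r z^†)) ginvol g phi y * f (y^† ⊙ (z^† ⊙ x)) =
    \sum_(y \in [set z^†]) ginvol g phi y * f (y^† ⊙ (z^† ⊙ x)).
  apply/esym/fsbig_widen; first by move=> _ ->.
  move=> y [yz nz] /=; rewrite /ginvol.
  have [->|py] := eqVneq (phi y^†) 0; first by rewrite conjC0 mul0r.
  by exfalso; apply: nz => /=; rewrite -(ginvK g y) (inj y^† z)// ginvK.
by rewrite fsbig_set1 /ginvol ginvK gmulVK// normCK; ring.
Qed.

(** The factor of [w] at [y^-1], coming from the adjoint, equals the one at [y^-1 x], so both gather
    on the right as a squared modulus. *)
Lemma gconv_weight w f x : (forall y, r y = r x -> w (y^† ⊙ x) = w y^†) ->
  gconv g (ginvol g (fun y => w y * f y)) (fun y => w y * f y) x =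
  gconv g (ginvol g f) (fun y => `|w y| ^+ 2 * f y) x.
Proof.
move=> hw; apply: eq_fsbigr => y /set_mem yx.
by rewrite /ginvol rmorphM normCK hw//=; ring.
Qed.

End Convolution.

(** * Bisections and the convolution of compactly supported functions *)

Section GroupoidTopology.
Variables (R : realType) (Q : topologicalType) (g : groupoid Q).
Implicit Types (x y z : Q) (f h k : Q -> R[i]).
Hypothesis hQ : topological_groupoid g.
Hypothesis hlc : locally_compact [set: Q].
Hypothesis hT2 : hausdorff_space Q.
Hypothesis hr : r_discrete g.

Local Notation "x ⊙ y" := (gmul g x y) (at level 40, left associativity).
Local Notation "x ^†" := (ginv g x) (at level 2, format "x ^†").
Local Notation r := (grange g).

Lemma ginv_continuous : continuous (ginv g).
Proof. exact: hQ.1. Qed.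

Lemma gmul_continuous (T : topologicalType) (a b : T -> Q) (t : T) :
  (\forall u \near t, composable g (a u) (b u)) ->
  {for t, continuous a} -> {for t, continuous b} ->
  {for t, continuous (fun u => a u ⊙ b u)}.
Proof.
move=> ab ac bc W /= Wt; have abt := nbhs_singleton ab.
have /subspace_continuousP/(_ (a t, b t) abt) := hQ.2; move/(_ _ Wt) => /= h.
have pc : (fun u => (a u, b u)) @ t --> (a t, b t) by exact: cvg_pair.
have h' := pc _ h; rewrite /= in h'.
by apply: filterS2 ab h' => u cu /(_ cu).
Qed.

Lemma grange_continuous : continuous r.
Proof.
move=> x; apply: gmul_continuous; [|exact: cvg_id|exact: ginv_continuous].
by near=> y; exact: composablegV.
Unshelve. all: by end_near. Qed.

Lemma grange_units_continuous : continuous (grange_units g).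
Proof. exact/continuous_comp_initial/grange_continuous. Qed.

(** Besides injectivity of range and source, the data include the saturation [W] of [U] under the
    range map and the continuous [sigma] sending a point to the element of [U] with the same range;
    continuity of convolutions rests on [sigma]. *)
Definition bisection (U : set Q) : Prop :=
  [/\ forall y z, U y -> U z -> r y = r z -> y = z,
      forall y z, U y -> U z -> r y^† = r z^† -> y = z &
      exists (W : set Q) (sigma : Q -> Q),
        [/\ open W, forall x, W x <-> exists2 z, U z & r z = r x,
            forall x, W x -> U (sigma x) /\ r (sigma x) = r x &
            forall x, W x -> {for x, continuous sigma}]].

Lemma bisection_ex x : exists2 U, bisection U & open U /\ U x.
Proof.
have [U0 [U0o U0x fU0 _ [h [hh hc]]]] := hr x.
have [V0 [V0o V0x _ _ [h' [hh' _]]]] := hr x^†.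
have unitsE y z : r y = r z -> grange_units g y = grange_units g z.
  by move=> e; apply: val_inj.
(* Inversion exchanges source and range, so a chart of the range map at the inverse of [x] makes the
   source injective. *)
pose U := U0 `&` ginv g @^-1` V0.
have Uo : open U.
  by apply: openI => //; apply: open_comp => // y _; exact: ginv_continuous.
have injr y z : U0 y -> U0 z -> r y = r z -> y = z.
  by move=> Uy Uz /unitsE e; rewrite -(hh y)// e hh.
exists U; last by [].
split; [by move=> y z [Uy _] [Uz _]; exact: injr| |].
  move=> y z [_ Uy] [_ Uz] /unitsE e; apply: (inv_inj (ginvK g)).
  by rewrite -(hh' y^†)// e hh'.
pose A := grange_units g @^-1` (grange_units g @` U0).
have Ao : open A by apply: open_comp => // y _; exact: grange_units_continuous.
pose sigma y := h (grange_units g y).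
have sc y : A y -> {for y, continuous sigma}.
  move=> Ay; apply: continuous_comp; first exact: grange_units_continuous.
  by move: hc; rewrite continuous_open_subspace// => /(_ _ (mem_set Ay)).
have AE y : A y <-> exists2 z, U0 z & r z = r y.
  split=> [[z Uz e]|[z Uz /unitsE e]]; exists z => //.
  by have := congr1 val e.
have As y : A y -> U0 (sigma y) /\ r (sigma y) = r y.
  by move=> /AE[z Uz e]; rewrite /sigma -(unitsE _ _ e) hh.
(* The section was built for [U0]; for [U], only the points with section value in [U] are kept. *)
exists (A `&` sigma @^-1` U), sigma; split.
- rewrite openE => y [Ay Uy]; apply: filterI; first exact: open_nbhs_nbhs.
  by apply: (sc y Ay); exact: open_nbhs_nbhs.
- move=> y; split=> [[Ay Uy]|[z Uz e]].
    by exists (sigma y) => //; exact: (As y Ay).2.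
  have Ay : A y by apply/AE; exists z => //; case: Uz.
  have e' : sigma y = z.
    by apply: injr; [exact: (As y Ay).1|case: Uz|rewrite (As y Ay).2].
  by split => //=; rewrite e'.
- by move=> y [Ay Uy]; split => //; exact: (As y Ay).2.
- by move=> y [Ay Uy]; exact: sc.
Qed.

Lemma bisection_fiber_finite f U : bisection U ->
  (forall x, f x != 0 -> U x) -> fiber_finite g f.
Proof.
move=> [inj _ _] fU u.
have [[y [yu fy]]|nex] := pselect (exists y, (gfiber g u `&` [set y | f y != 0]) y).
  apply: (@sub_finite_set _ _ [set y]) => // z [zu fz] /=.
  by apply: inj; [exact: fU|exact: fU|rewrite zu yu].
by rewrite (_ : _ `&` _ = set0)//; apply/seteqP; split=> // z hz; apply: nex; exists z.
Qed.

Lemma Cc_fiber_finite f : Cc f -> fiber_finite g f.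
Proof.
apply: (Cc_ind hlc hT2 bisection_ex).
- by move=> u; rewrite (_ : _ `&` _ = set0)//; apply/seteqP; split=> // z [_] /=; rewrite eqxx.
- move=> {}f h _ _ ff fh u.
  apply: (@sub_finite_set _ _ ((gfiber g u `&` [set y | f y != 0]) `|`
    (gfiber g u `&` [set y | h y != 0]))); last by rewrite finite_setU.
  move=> y [uy] /= fh0; have [fy|fy] := eqVneq (f y) 0; last by left.
  by right; split => //=; apply: contra fh0 => /eqP ->; rewrite fy addr0.
move=> {}f U _ BU fU; apply: (bisection_fiber_finite BU) => x fx.
by apply: fU; exact: Cc_supp.
Qed.

Lemma gconv_section f h U x y : bisection U -> (forall x, f x != 0 -> U x) ->
  U y -> r y = r x -> gconv g f h x = f y * h (y^† ⊙ x).
Proof.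
move=> [inj _ _] fU Uy yx; rewrite /gconv -[RHS](@fsbig_set1 _ 0 +%R _ y (fun y => f y * h (y^† ⊙ x))).
apply/esym/fsbig_widen; first by move=> _ ->.
move=> z [zx zy] /=; have [->|fz] := eqVneq (f z) 0; first by rewrite mul0r.
by exfalso; apply: zy => /=; apply: inj; [exact: fU|exact: Uy|rewrite zx yx].
Qed.

(** The function [h] is only asked to be continuous, so that [chi] and the constant 1 are
    allowed. *)
Lemma gconv_continuous f h : Cc f -> continuous (h : Q -> R[i]^o) ->
  continuous (gconv g f h : Q -> R[i]^o).
Proof.
move=> + hc; move: f; apply: (Cc_ind hlc hT2 bisection_ex).
- have -> : gconv g (fun=> 0) h = fun=> 0.
    by apply/funext => x; rewrite /gconv fsbig1// => y _; rewrite mul0r.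
  exact: cst_continuous.
- move=> f k fC kC fc kc x.
  have -> : gconv g (fun x => f x + k x) h = fun x => gconv g f h x + gconv g k h x.
    apply/funext => y; have := gconvPl 1 h y (Cc_fiber_finite fC) (Cc_fiber_finite kC).
    by under eq_fun do rewrite mul1r; rewrite mul1r.
  by apply: (@cvgD _ R[i]^o); [exact: fc|exact: kc].
move=> f U [fc fK] BU fU x; have [inj _ [W [sigma [Wo WE Ws sc]]]] := BU.
set K := closure _ in fK fU.
have fK' y : f y != 0 -> K y by move=> fy; exact: Cc_supp.
have fU' y : f y != 0 -> U y by move=> /fK'/fU.
have rKcl : closed (r @` K).
  apply: compact_closed => //; apply: continuous_compact => //.
  exact/continuous_subspaceT/grange_continuous.
have Ccl : closed (r @^-1` (r @` K)).
  by apply: closed_comp => // y _; exact: grange_continuous.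
(* Near the saturation of the support, [sigma] gives a one-term formula. The complement of the
   saturation is open, since the range of a compact set is closed, and the convolution vanishes
   there. *)
have [[y Ky yx]|nCx] := pselect ((r @^-1` (r @` K)) x).
  have Wx : W x by apply/WE; exists y => //; exact: fU.
  have E : \forall z \near x, f (sigma z) * h ((sigma z)^† ⊙ z) = gconv g f h z.
    have : nbhs x W by exact: open_nbhs_nbhs.
    apply: filterS => z /Ws[Uz sz].
    by rewrite (gconv_section h BU fU' Uz sz).
  rewrite /continuous_at -(nbhs_singleton E).
  apply: cvg_trans; first exact: (near_eq_cvg E).
  apply: (@cvgM R[i]).
    by apply: (@cvg_comp _ _ _ sigma f); [exact: sc|exact: fc].
  apply: (@cvg_comp _ _ _ (fun z => (sigma z)^† ⊙ z) h); last exact: hc.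
  apply: (@gmul_continuous Q (fun z => (sigma z)^†) id x); last exact: cvg_id.
    have : nbhs x W by exact: open_nbhs_nbhs.
    by apply: filterS => z /Ws[_ sz]; exact: composableVr.
  by apply: (@cvg_comp _ _ _ sigma (ginv g)); [exact: sc|exact: ginv_continuous].
have Z z : ~ (r @^-1` (r @` K)) z -> gconv g f h z = 0.
  move=> nCz; rewrite /gconv fsbig1// => y yz.
  have [->|fy] := eqVneq (f y) 0; first by rewrite mul0r.
  by exfalso; apply: nCz; exists y => //; exact: fK'.
have E : \forall z \near x, 0 = gconv g f h z.
  have : nbhs x (~` (r @^-1` (r @` K))) by apply: open_nbhs_nbhs; split => //; exact: closed_openC.
  by apply: filterS => z /Z.
rewrite /continuous_at -(nbhs_singleton E).
apply: cvg_trans; first exact: (near_eq_cvg E).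
exact: cvg_cst.
Qed.

(** The support lies in the product of the two supports, the image of a compact set because
    composable pairs form the closed set [D], a preimage of the diagonal. *)
Lemma gconv_Cc f h : Cc f -> Cc h -> Cc (gconv g f h).
Proof.
move=> fC hC; have [fc fK] := fC; have [hc hK] := hC.
set K := closure _ in fK; set L := closure _ in hK.
pose D := [set p : Q * Q | r p.1^† = r p.2].
have Dcl : closed D.
  have dc : continuous (fun p : Q * Q => (r p.1^†, r p.2)).
    move=> p; apply: cvg_pair.
      apply: (@cvg_comp _ _ _ (fun p : Q * Q => p.1) (fun x => r x^†)); first exact: cvg_fst.
      apply: (@cvg_comp _ _ _ (ginv g) r); [exact: ginv_continuous|exact: grange_continuous].
    by apply: (@cvg_comp _ _ _ (fun p : Q * Q => p.2) r); [exact: cvg_snd|exact: grange_continuous].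
  have diag : closed [set p : Q * Q | p.1 = p.2].
    move=> [a b] ab; apply: hT2 => A B Aa Bb.
    have [|[u v] [/= uv [/= Au Bv]]] := ab (A `*` B); first by exists (A, B).
    by exists u; split => //; rewrite uv.
  by have := closed_comp (fun p _ => dc p) diag.
have Ecpt : compact (K `*` L `&` D) by apply: compact_closedI => //; exact: compact_setX.
have ED : K `*` L `&` D `<=` [set p | composable g p.1 p.2].
  by move=> p [_ pD]; exact/composableP.
apply: (@Cc_sub _ _ ((fun p : Q * Q => p.1 ⊙ p.2) @` (K `*` L `&` D)) _ hT2).
- exact: gconv_continuous fC hc.
- by apply: continuous_compact Ecpt; exact: continuous_subspaceW ED hQ.2.
move=> x fx; apply: contrapT => nK; move: fx; rewrite /gconv fsbig1 ?eqxx// => y yx.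
apply/eqP; apply: contrapT => /negP; rewrite mulf_eq0 => /norP[fy hy]; apply: nK.
exists (y, y^† ⊙ x); last by rewrite /= gmulVK.
by split; [split; exact: Cc_supp|rewrite /D /= grange_divl].
Qed.

Lemma ginvol_Cc f : Cc f -> Cc (ginvol g f).
Proof.
move=> [fc fK]; apply: (@Cc_sub _ _ (ginv g @` closure [set x | f x != 0]) _ hT2).
- move=> x; apply: (@continuous_conj _ _ (fun x => f x^†)).
  by apply: (@cvg_comp _ _ _ (ginv g) f); [exact: ginv_continuous|exact: fc].
- apply: continuous_compact fK; apply: continuous_subspaceT; exact: ginv_continuous.
move=> x; rewrite /ginvol conjC_eq0 => fx; exists x^†; last exact: ginvK.
exact: Cc_supp.
Qed.

End GroupoidTopology.

(** * Restriction to the kernel and extension by zero *)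

Section KernelRestriction.
Variables (R : realType) (Q : topologicalType) (g : groupoid Q).
Implicit Types (x y z : Q) (f h k : Q -> R[i]).
Hypothesis hT2 : hausdorff_space Q.
Variables (G : groupType) (c : Q -> G) (hc : groupoid_hom g c).
Hypothesis hcont : continuous (c : Q -> discrete_topology G).

Local Notation "x ⊙ y" := (gmul g x y) (at level 40, left associativity).
Local Notation "x ^†" := (ginv g x) (at level 2, format "x ^†").
Local Notation r := (grange g).
Local Notation N := (ghom_ker c).
Local Notation gN := (kernel_groupoid hc).

Lemma ghom_range x : c (r x) = 1%g.
Proof.
have [cx ex] := gmul_id g x; have := hc cx; rewrite ex => e.
by apply: (mulIg (c x)); rewrite mul1g -e.
Qed.

Lemma ghom_inv x : c x^† = ((c x)^-1)%g.
Proof.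
have := hc (composablegV g x); rewrite -/(r x) ghom_range => e.
by apply: (mulgI (c x)); rewrite mulgV -e.
Qed.

Lemma ghom_div x y : r y = r x -> c (y^† ⊙ x) = ((c y)^-1 * c x)%g.
Proof. by move=> e; rewrite hc ?ghom_inv//; exact: composableVr. Qed.

Definition ker_indic x : R[i] := (c x == 1%g)%:R.

Lemma ker_indic_div x y : c x = 1%g -> r y = r x ->
  ker_indic (y^† ⊙ x) = ker_indic y.
Proof.
move=> cx yx; rewrite /ker_indic ghom_div// cx mulg1; by rewrite invg_eq1.
Qed.

Lemma ghom_locally_constant x : \forall y \near x, c y = c x.
Proof.
exact: (@hcont x _ (@discrete_set1 (discrete_topology G) (c x))).
Qed.

Lemma ker_indic_continuous : continuous (ker_indic : Q -> R[i]^o).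
Proof.
move=> x; have E : \forall y \near x, ker_indic x = ker_indic y.
  by apply: filterS (ghom_locally_constant x) => y cy; rewrite /ker_indic cy.
by apply: cvg_trans; [exact: (near_eq_cvg E)|exact: cvg_cst].
Qed.

Lemma ker_val_mul (x y : N) : composable gN x y ->
  val (gmul gN x y) = val x ⊙ val y.
Proof.
move=> xy; apply/insubdK/mem_set; rewrite /ghom_ker /= hc//.
by rewrite (set_mem (valP x)) (set_mem (valP y)) mulg1.
Qed.

Lemma ker_val_inv (x : N) : val (ginv gN x) = (val x)^†.
Proof.
apply/insubdK/mem_set; rewrite /ghom_ker /= ghom_inv.
by rewrite (set_mem (valP x)) invg1.
Qed.

Lemma ker_val_range (x : N) : val (grange gN x) = r (val x).
Proof. by rewrite /grange ker_val_mul ?ker_val_inv//; exact: composablegV. Qed.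

Definition ker_restrict f (x : N) : R[i] := f (val x).

Lemma ker_restrict_ginvol f :
  ginvol gN (ker_restrict f) = ker_restrict (ginvol g f).
Proof. by apply/funext => x; rewrite /ginvol /ker_restrict ker_val_inv. Qed.

(** One factor [ker_indic] suffices: if [x] and [y] lie in the kernel, so does [y^-1 x]. *)
Lemma ker_restrict_gconv f h : gconv gN (ker_restrict f) (ker_restrict h) =
  ker_restrict (gconv g (fun x => ker_indic x * f x) h).
Proof.
apply/funext => x; rewrite /ker_restrict /gconv.
pose A := gfiber g (r (val x)) `&` N.
transitivity (\sum_(y \in A) ker_indic y * f y * h (y^† ⊙ val x)); last first.
  apply: fsbig_widen; first by move=> y [].
  move=> y [yx nA] /=; rewrite /ker_indic; case: eqP => [cy|_]; last by rewrite !mul0r.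
  by exfalso; exact: nA.
have rE (y : N) : grange gN y = grange gN x <-> r (val y) = r (val x).
  by rewrite -!ker_val_range; split=> [->//|/val_inj].
have bij : set_bij (gfiber gN (grange gN x)) A (val : N -> Q).
  split.
  - by move=> y /rE e; split => //; exact: (set_mem (valP y)).
  - by move=> y z _ _ /val_inj.
  move=> y [yx cy]; exists (exist _ y (mem_set cy)) => //.
  exact/rE.
rewrite (@reindex_fsbig _ _ _ N Q val _ _ _ bij).
apply: eq_fsbigr => y /set_mem /rE yx; rewrite /ker_indic (set_mem (valP y)) eqxx mul1r.
rewrite ker_val_mul ?ker_val_inv//.
by apply: composableVr; apply/rE.
Qed.

(* Restriction to the kernel is a conditional expectation. *)
Lemma gconv_ker_indic a b h x : fiber_finite g a -> fiber_finite g b ->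
  c x = 1%g -> gconv g (fun y => ker_indic y * gconv g a b y) h x =
  gconv g a (gconv g b (fun y => ker_indic y * h y)) x.
Proof.
move=> fa fb cx; rewrite -gconvA// [LHS]/gconv [RHS]/gconv.
apply: eq_fsbigr => y /set_mem yx; rewrite (ker_indic_div cx yx); ring.
Qed.

(** The convolution at a point [v] is the sum of [f] over the [z] with the range and the value of
    [c] of [v]; both are the same for [y^-1 x] and [y^-1]. *)
Lemma gconv_ker_indic_div f x y : c x = 1%g -> r y = r x ->
  gconv g f ker_indic (y^† ⊙ x) = gconv g f ker_indic y^†.
Proof.
move=> cx yx; rewrite /gconv grange_divl//; apply: eq_fsbigr => z /set_mem zy.
have rz : r z = r y^† by [].
rewrite /ker_indic (ghom_div rz) ghom_div ?grange_divl//.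
by rewrite (ghom_div yx) cx mulg1 ghom_inv.
Qed.

Lemma ker_closed : closed N.
Proof.
move=> x; move=> /(_ _ (ghom_locally_constant x)) [y [cy cyx]].
by rewrite /ghom_ker /= -cyx.
Qed.

Lemma ker_open : open N.
Proof.
rewrite openE => x cx; apply: filterS (ghom_locally_constant x) => y.
by rewrite /ghom_ker /= => ->.
Qed.

Lemma ker_val_continuous : continuous (val : N -> Q).
Proof. exact: initial_continuous. Qed.

Lemma ker_restrict_Cc f : Cc f -> Cc (ker_restrict f).
Proof.
move=> [fc fK]; set K := closure _ in fK.
apply: (@Cc_closed_sub _ _ ((val : N -> Q) @^-1` K)).
- by apply: closed_comp => [x _|]; [exact: ker_val_continuous|exact: closed_closure].
- by move=> x; apply: (@cvg_comp _ _ _ (val : N -> Q) f); [exact: ker_val_continuous|exact: fc].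
(* The image filter clusters at a point of [K] in the closed set [N]; the cluster point pulls back
   because [N] carries the induced topology. *)
- move=> F FF FK.
  have KN : compact (K `&` N) by apply: compact_closedI => //; exact: ker_closed.
  have [|p [[Kp Np] hp]] := KN _ (fmap_proper_filter (val : N -> Q) FF).
    by apply: (@filterS _ F _ _ _ _ FK) => -[x Nx] Kx; split; [exact: Kx|exact: set_mem Nx].
  exists (exist _ p (mem_set Np)); split => // A B FA.
  move=> [_ [[W oW <-] /= Wp] WB].
  have [|_ [[y Ay <-] Wy]] := hp (val @` A) W _ (open_nbhs_nbhs (conj oW Wp)).
    by apply: (@filterS _ F _ _ _ _ FA) => y Ay; exists y.
  by exists y; split => //; exact: WB.
- by move=> x fx; exact: Cc_supp.
Qed.

Lemma extend0_val (f : N -> R[i]) (x : N) : extend0 f (val x) = f x.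
Proof. by rewrite /extend0 valK. Qed.

Lemma extend0_out (f : N -> R[i]) x : c x != 1%g -> extend0 f x = 0.
Proof.
move=> cx; rewrite /extend0 insubN//; apply: contra cx => /set_mem cx.
exact/eqP.
Qed.

Lemma extend0K (f : N -> R[i]) : ker_restrict (extend0 f) = f.
Proof. by apply/funext => x; exact: extend0_val. Qed.

Lemma ker_indic_extend0 (f : N -> R[i]) :
  (fun x => ker_indic x * extend0 f x) = extend0 f.
Proof.
apply/funext => x; rewrite /ker_indic; have [|cx] := eqVneq (c x) 1%g.
  by rewrite mul1r.
by rewrite mul0r extend0_out.
Qed.

(** As [c] is locally constant, [N] is clopen: openness gives continuity at its points, and every
    other point has a neighbourhood where the extension is 0. *)
Lemma extend0_Cc (f : N -> R[i]) : Cc f -> Cc (extend0 f).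
Proof.
move=> [fc fK]; apply: (@Cc_sub _ _ ((val : N -> Q) @` closure [set x | f x != 0])) => //.
- move=> x; have [cx|/eqP cx] := pselect (c x = 1%g); last first.
    have E : \forall y \near x, 0 = extend0 f y.
      by apply: filterS (ghom_locally_constant x) => y cy; rewrite extend0_out// cy.
    rewrite /continuous_at -(nbhs_singleton E).
    by apply: cvg_trans; [exact: (near_eq_cvg E)|exact: cvg_cst].
  pose x' : N := exist _ x (mem_set cx).
  rewrite /continuous_at -[x in extend0 f x]/(val x') extend0_val => V /(fc x').
  move=> [_ [[W oW <-] /= Wx] WV].
  have WN : nbhs x (W `&` N).
    by apply: open_nbhs_nbhs; split => //; apply: openI => //; exact: ker_open.
  apply: filterS WN => y [Wy cy] /=.
  by rewrite -[y]/(val (exist _ y (mem_set cy) : N)) extend0_val; apply: WV.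
- by apply: continuous_compact => //; apply: continuous_subspaceT; exact: ker_val_continuous.
move=> x; have [cx|/eqP cx] := pselect (c x = 1%g); last by rewrite extend0_out ?eqxx.
pose x' : N := exist _ x (mem_set cx).
rewrite -[x]/(val x') extend0_val => fx; exists x' => //.
exact: Cc_supp.
Qed.

End KernelRestriction.

(** * The functional induced from the kernel *)

Section InducedFunctional.
Variables (R : realType) (Q : topologicalType) (g : groupoid Q).
Implicit Types (x y z : Q) (f h k : Q -> R[i]).
Hypothesis hQ : topological_groupoid g.
Hypothesis hlc : locally_compact [set: Q].
Hypothesis hT2 : hausdorff_space Q.
Hypothesis hr : r_discrete g.
Variables (G : groupType) (c : Q -> G) (hc : groupoid_hom g c).
Hypothesis hcont : continuous (c : Q -> discrete_topology G).
Variables (H : hilbertSpace R) (rho : (ghom_ker c -> R[i]) -> H -> H).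
Hypothesis hrho : Cc_rep (kernel_groupoid hc) rho.
Variable xi : H.

Local Notation "x ⊙ y" := (gmul g x y) (at level 40, left associativity).
Local Notation "x ^†" := (ginv g x) (at level 2, format "x ^†").
Local Notation r := (grange g).
Local Notation N := (ghom_ker c).
Local Notation gN := (kernel_groupoid hc).
Local Notation "f ** h" := (gconv g f h) (at level 40, left associativity).
Local Notation "f ^#" := (ginvol g f) (at level 2, format "f ^#").
Local Notation chi := (@ker_indic R Q G c).
Local Notation res := (@ker_restrict R Q G c).
Local Notation gconvC := (gconv_Cc hQ hlc hT2 hr).
Local Notation ginvolC := (ginvol_Cc hQ hT2).
Local Notation resC := (ker_restrict_Cc hcont).
Local Notation finC := (Cc_fiber_finite hQ hlc hT2 hr).

Definition induced_state f : R[i] := hs_dot H (rho (res f) xi) xi.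

Lemma induced_linear a f h : Cc f -> Cc h ->
  induced_state (fun x => a * f x + h x) = a * induced_state f + induced_state h.
Proof.
move=> fC hC; have [_ rl _ _] := hrho.
have := rl a _ _ (resC fC) (resC hC) xi.
rewrite /induced_state [X in rho X xi = _](_ : _ = res (fun x => a * f x + h x))// => ->.
by rewrite linearPl.
Qed.

Lemma inducedD f h : Cc f -> Cc h ->
  induced_state (fun x => f x + h x) = induced_state f + induced_state h.
Proof.
move=> fC hC; rewrite -[X in X + _]mul1r -induced_linear//.
by congr induced_state; apply/funext => x; rewrite mul1r.
Qed.

Lemma induced0 : induced_state (fun=> 0) = 0.
Proof.
have C0 := Cc0 R Q; have e := induced_linear (-1) C0 C0.
rewrite (_ : (fun=> -1 * 0 + 0) = (fun=> 0)) in e; last first.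
  by apply/funext => x; rewrite mulr0 addr0.
by rewrite e mulN1r addNr.
Qed.

Lemma induced_sum (I : eqType) (s : seq I) (F : I -> Q -> R[i]) :
  (forall i, i \in s -> Cc (F i)) ->
  Cc (fun x => \sum_(i <- s) F i x) /\
  induced_state (fun x => \sum_(i <- s) F i x) = \sum_(i <- s) induced_state (F i).
Proof.
elim: s => [|i s IH] FC.
  under eq_fun do rewrite big_nil; rewrite big_nil induced0; split => //; exact: Cc0.
have [j js|sC e] := IH; first by apply: FC; rewrite inE js orbT.
have iC := FC i (mem_head _ _).
under eq_fun do rewrite big_cons; rewrite big_cons -e; split; first exact: CcD.
exact: inducedD.
Qed.

Lemma induced_ginvol f : Cc f -> induced_state f^# = (induced_state f)^*.
Proof.
move=> fC; have [_ _ _ ra] := hrho.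
rewrite /induced_state -(ker_restrict_ginvol hc) ra; last exact: resC.
by rewrite hermC expr0 mul1r.
Qed.

Lemma eq_induced f h : (forall x, c x = 1%g -> f x = h x) -> induced_state f = induced_state h.
Proof.
move=> fh; congr (hs_dot H (rho _ xi) xi); apply/funext => x.
by apply: fh; exact: (set_mem (valP x)).
Qed.

(** On the kernel the argument is the product in C_c(N) of the adjoint of [res h] with [res h], even
    when [h] is not supported there. *)
Lemma induced_square h : Cc h ->
  induced_state ((fun x => chi x * h^# x) ** h) = `|rho (res h) xi| ^+ 2.
Proof.
move=> hC; have [_ _ rm ra] := hrho.
rewrite /induced_state -(ker_restrict_gconv hc) -(ker_restrict_ginvol hc).
have rC := resC hC; rewrite rm//; last by rewrite ker_restrict_ginvol; exact/resC/ginvolC.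
by rewrite ra// hs_norm.
Qed.

Lemma gconv_sumr (I : Type) (s : seq I) f (F : I -> Q -> R[i]) x :
  fiber_finite g f ->
  (f ** (fun y => \sum_(i <- s) F i y)) x = \sum_(i <- s) (f ** F i) x.
Proof.
move=> ff; elim: s => [|i s IH].
  by under eq_fun do rewrite big_nil; rewrite big_nil /gconv fsbig1// => y _; rewrite mulr0.
under eq_fun do rewrite big_cons; rewrite big_cons -IH.
have := gconvPr 1 (F i) (fun y => \sum_(j <- s) F j y) x ff.
by rewrite mul1r => <-; congr gconv; apply/funext => y; rewrite mul1r.
Qed.

Lemma chi_continuous : continuous (chi : Q -> R[i]^o).
Proof. exact: ker_indic_continuous. Qed.

Lemma bisection_source_injective (p : Q -> R[i]) (U : set Q) : bisection g U ->
  (forall x, p x != 0 -> U x) -> source_injective g p.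
Proof. by move=> [_ inj _] pU y z py pz; apply: inj; exact: pU. Qed.

(** After [gconv_source_injective] rewrites the weighted function, [gconv_ker_indic] moves [p] to
    the left factor, which leaves the case [h = p^# ** f] of [induced_square]. *)
Lemma induced_term_ge0 p f : Cc p -> Cc f -> source_injective g p ->
  0 <= induced_state (f^# ** (fun x => ((fun y => `|p y| ^+ 2) ** chi) x * f x)).
Proof.
move=> pC fC inj.
have -> : (fun x => ((fun y => `|p y| ^+ 2) ** chi) x * f x) =
    p ** (fun y => chi y * (p^# ** f) y).
  by apply/funext => x; rewrite gconv_source_injective.
have hC : Cc (p^# ** f) by apply: gconvC => //; exact: ginvolC.
rewrite -(@eq_induced ((fun y => chi y * (p^# ** f)^# y) ** (p^# ** f))).
  by rewrite induced_square// exprn_ge0.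
move=> x cx; rewrite -(gconv_ker_indic hc)//; last 2 first.
- exact: finC (ginvolC fC).
- exact: finC pC.
apply: eq_fsbigr => y _; congr (_ * _ * _).
by rewrite ginvol_gconv ginvolK.
Qed.

Lemma CcMr m f : continuous (m : Q -> R) -> Cc f -> Cc (fun x => (m x)%:C%C * f x).
Proof.
move=> mc; apply: CcM => x.
by apply: (@continuous_real_complex _ _ m); exact: mc.
Qed.

Lemma normc_sqrt (t : R) : 0 <= t -> `|(Num.sqrt t)%:C%C : R[i]| ^+ 2 = t%:C%C.
Proof.
by move=> t0; rewrite normc_real -rmorphXn /= real_normK ?num_real// sqr_sqrtr.
Qed.

(** The term [y = x] contributes [f x] and the others are nonnegative. Hence a weight built from
    bumps dominates their sum. *)
Lemma gconv_chi_ge f x : fiber_finite g f -> (forall y, 0 <= f y) ->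
  f x <= (f ** chi) x.
Proof.
move=> ff f0; rewrite /gconv; pose A := gfiber g (r x) `&` [set y | f y != 0].
rewrite -(@fsbig_widen _ _ _ _ A); last 2 first.
- by move=> y [].
- move=> y [yx /not_andP[//|/negP]] /=; rewrite negbK => /eqP ->; exact: mul0r.
have t0 y : 0 <= f y * chi (y^† ⊙ x) by rewrite mulr_ge0.
have [->|fx] := eqVneq (f x) 0; first by rewrite fsumr_ge0.
rewrite (fsbigD1 x A)//=; last exact: ff.
rewrite /ker_indic ghom_div// mulVg eqxx mulr1 lerDl fsumr_ge0//.
Qed.

Lemma induced_ge0 f : Cc f -> 0 <= induced_state (f^# ** f).
Proof.
(* With W the sum of the |p_u|^2 * chi, T = max W 1 and f' = f / sqrt T, one has W = T on the
   support of f, so f^* f = f'^* (W f') on the kernel. *)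
move=> fC; have [fc fK] := fC.
have [s [sc sB sK s1]] := bump_cover R hlc hT2 fK (fun x _ => bisection_ex hQ hr x).
(* Square roots make the squared moduli equal to the bumps themselves. *)
pose p (u : Q -> R) x : R[i] := (Num.sqrt (u x))%:C%C.
have p_neq0 u x : u x = 0 -> p u x = 0 by rewrite /p => ->; rewrite sqrtr0.
have pE u : u \in s -> (fun x => `|p u x| ^+ 2) = (fun x => (u x)%:C%C).
  by move=> us; apply/funext => x; rewrite normc_sqrt//; exact: (sc u us).2.
have contc (u : Q -> R) : continuous u -> continuous (fun x => (u x)%:C%C : R[i]^o).
  by move=> uc x; apply: (@continuous_real_complex _ _ u); exact: uc.
have sqrtc (u : Q -> R) : continuous u -> continuous (fun x => Num.sqrt (u x)).
  by move=> uc x; apply: (@cvg_comp _ _ _ u Num.sqrt); [exact: uc|exact: sqrt_continuous].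
have pC u : u \in s -> Cc (p u).
  move=> us; apply: (@Cc_sub _ _ _ _ hT2 _ (sK u us)).
    exact/contc/sqrtc/(sc u us).1.
  move=> x px; apply: subset_closure => /=; apply: contra px => /eqP ux.
  by rewrite p_neq0.
have uC u : u \in s -> Cc (fun x => (u x)%:C%C : R[i]).
  move=> us; apply: (@Cc_sub _ _ _ _ hT2 _ (sK u us)); first exact/contc/(sc u us).1.
  move=> x px; apply: subset_closure => /=; apply: contra px => /eqP ->.
  by rewrite eqxx.
have pinj u : u \in s -> source_injective g (p u).
  move=> us; have [U UB uU] := sB u us; apply: (bisection_source_injective UB) => x px.
  apply/uU/subset_closure => /=; apply: contra px => /eqP ux.
  by rewrite p_neq0.
pose V u := (fun y => `|p u y| ^+ 2) ** chi.
have VC u : u \in s -> continuous (V u : Q -> R[i]^o).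
  move=> us; rewrite /V (pE u us).
  exact: (gconv_continuous hQ hlc hT2 hr (uC u us) chi_continuous).
pose W x := \sum_(u <- s) V u x.
have Wge x : (\sum_(u <- s) u x)%:C%C <= W x.
  rewrite rmorph_sum /= /W big_seq [leRHS]big_seq; apply: ler_sum => u us.
  rewrite /V (pE u us); apply: (@gconv_chi_ge (fun x => (u x)%:C%C)).
    exact: finC (uC u us).
  by move=> y; rewrite ler0c; exact: (sc u us).2.
have Wc : continuous (W : Q -> R[i]^o).
  rewrite /W; elim: (s) VC => [|u t IH] tC x.
    under eq_fun do rewrite big_nil; exact: cvg_cst.
  under eq_fun do rewrite big_cons.
  apply: (@cvgD _ R[i]^o); first by apply: tC; rewrite mem_head.
  by apply: IH => v vt; apply: tC; rewrite inE vt orbT.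
pose T x := Num.max (complex.Re (W x)) 1.
have T0 x : 0 < T x by rewrite lt_max ltr01 orbT.
have Tc : continuous T.
  move=> x; apply: continuous_max; last exact: cvg_cst.
  by apply: (@continuous_Re _ _ W); exact: Wc.
have TE x : f x != 0 -> (T x)%:C%C = W x.
  move=> /Cc_supp/s1 h1; have := Wge x.
  have h1' : 1 <= (\sum_(u <- s) u x)%:C%C :> R[i] by rewrite (lecR 1).
  (* Comparable numbers of [R[i]] have equal imaginary parts, so [1 <= W x] makes [W x] real. *)
  move=> /(le_trans h1'); rewrite lecE /= => /andP[/eqP im re].
  by rewrite /T max_l// [RHS]complexE im mulr0 addr0.
have sT0 x : Num.sqrt (T x) != 0 by rewrite sqrtr_eq0 -ltNge.
pose w x : R[i] := (Num.sqrt (T x))%:C%C.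
pose f' x : R[i] := ((Num.sqrt (T x))^-1)%:C%C * f x.
have f'C : Cc f'.
  apply: CcMr => // x; apply: cvgV => //; exact: sqrtc.
have fE : f = fun x => w x * f' x.
  by apply/funext => x; rewrite /w /f' mulrA -rmorphM /= divff// mul1r.
have wE x : `|w x| ^+ 2 * f' x = \sum_(u <- s) V u x * f' x.
  rewrite normc_sqrt ?ltW// -mulr_suml -/(W x).
  have [fx|fx] := eqVneq (f x) 0; first by rewrite /f' fx !mulr0.
  by rewrite TE.
have Vker u x y : c x = 1%g -> r y = r x -> V u (y^† ⊙ x) = V u y^†.
  by move=> cx yx; exact: (gconv_ker_indic_div hc).
have wker x y : c x = 1%g -> r y = r x -> w (y^† ⊙ x) = w y^†.
  move=> cx yx; rewrite /w /T /W; congr (Num.sqrt (Num.max (complex.Re _) _))%:C%C.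
  by apply: eq_bigr => u _; exact: Vker.
have Vge0 u : u \in s -> 0 <= induced_state (f'^# ** (fun x => V u x * f' x)).
  by move=> us; exact: (induced_term_ge0 (pC u us) f'C (pinj u us)).
clearbody V w f'; clear T T0 Tc TE sT0 Wge Wc W.
have f''C := ginvolC f'C.
have tC u : u \in s -> Cc (f'^# ** (fun x => V u x * f' x)).
  by move=> us; exact: (gconvC f''C (CcM (VC u us) f'C)).
have [_ sumE] := induced_sum tC.
rewrite (@eq_induced _ (fun x => \sum_(u <- s) (f'^# ** (fun x => V u x * f' x)) x)).
  by rewrite sumE big_seq; apply: sumr_ge0 => u us; exact: Vge0.
move=> x cx; rewrite fE gconv_weight; last by move=> y; exact: wker.
rewrite (_ : (fun y => _ * _) = (fun y => \sum_(u <- s) V u y * f' y)).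
  by rewrite gconv_sumr//; exact: finC f''C.
by apply/funext => y; exact: wE.
Qed.

Lemma inducedZ a f : Cc f -> induced_state (fun x => a * f x) = a * induced_state f.
Proof.
move=> fC; have := induced_linear a fC (Cc0 R Q); rewrite induced0 addr0 => <-.
by congr induced_state; apply/funext => x; rewrite addr0.
Qed.

Lemma gconvZr a f h x : (f ** (fun y => a * h y)) x = a * (f ** h) x.
Proof. by rewrite /gconv mulr_fsumr; apply: eq_fsbigr => y _; ring. Qed.

Lemma induced_gconv_le b U (M : R[i]) f : Cc b -> bisection g U ->
  (forall x, b x != 0 -> U x) -> 0 <= M -> (forall x, `|b x| <= M) -> Cc f ->
  induced_state ((b ** f)^# ** (b ** f)) <= M ^+ 2 * induced_state (f^# ** f).
Proof.
(* b^* (b f) = S f with 0 <= S <= M^2, so M^2 f^* f - (b f)^* (b f) = f'^* f' for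
   f' = sqrt (M^2 - S) f. *)
move=> bC [injr injs _] bU M0 bM fC.
have b'C : Cc b^# by exact: ginvolC.
have b'0 y : b^# y != 0 -> U y^† by rewrite /ginvol conjC_eq0 => /bU.
have b'inj : source_injective g b^#.
  by move=> y z /b'0 Uy /b'0 Uz e; apply: (inv_inj (ginvK g)); exact: injr.
(* [S] depends only on the range of its argument, as [gconv_weight] requires of [w]. Source
   injectivity on [U] leaves at most one term, bounded by [M ^+ 2]; range injectivity makes [b^#]
   source-injective, so [gconv_source_injective] applies with [m = 1]. *)
pose S := (fun y => `|b^# y| ^+ 2) ** (fun=> 1).
have SE x : 0 <= S x /\ S x <= M ^+ 2.
  have t0 y : 0 <= `|b^# y| ^+ 2 * 1 :> R[i] by rewrite mulr1 exprn_ge0.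
  split; first exact: fsumr_ge0.
  have [[y [yx by0]]|nex] := pselect (exists y, gfiber g (r x) y /\ b^# y != 0).
    rewrite /S /gconv -(@fsbig_widen _ _ _ _ [set y]).
    - by rewrite fsbig_set1 mulr1 ler_pXn2r ?nnegrE// /ginvol norm_conjC.
    - by move=> _ ->.
    move=> z [zx zy] /=; have [->|bz] := eqVneq (b^# z) 0.
      by rewrite normr0 expr0n mul0r.
    exfalso; apply: zy => /=; apply: (inv_inj (ginvK g)); apply: injs; [exact: b'0|exact: b'0|].
    by rewrite !ginvK zx yx.
  rewrite /S /gconv fsbig1 ?exprn_ge0// => y yx.
  have [->|bz] := eqVneq (b^# y) 0; first by rewrite normr0 expr0n mul0r.
  by exfalso; apply: nex; exists y.
have Sc : continuous (S : Q -> R[i]^o).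
  apply: (gconv_continuous hQ hlc hT2 hr); last by move=> x; exact: cvg_cst.
  have -> : (fun y => `|b^# y| ^+ 2) = (fun y => (b^# y)^* * b^# y).
    by apply/funext => y; rewrite normCK mulrC.
  apply: CcM => // x; apply: (@continuous_conj _ _ b^#); exact: b'C.1.
pose t x := complex.Re (M ^+ 2 - S x).
have tE x : (t x)%:C%C = M ^+ 2 - S x.
  by rewrite RRe_real// ger0_real// subr_ge0; case: (SE x).
have t0 x : 0 <= t x by rewrite -ler0c tE subr_ge0; case: (SE x).
have tc : continuous t.
  move=> x; apply: (@continuous_Re _ _ (fun x => M ^+ 2 - S x)).
  by apply: (@cvgB _ R[i]^o); [exact: cvg_cst|exact: Sc].
pose w x : R[i] := (Num.sqrt (t x))%:C%C.
have f'C : Cc (fun x => w x * f x).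
  apply: CcMr => // x.
  by apply: (@cvg_comp _ _ _ t Num.sqrt); [exact: tc|exact: sqrt_continuous].
have bfC : Cc (b ** f) by exact: gconvC.
have key x : M ^+ 2 * (f^# ** f) x =
    ((fun x => w x * f x)^# ** (fun x => w x * f x)) x + ((b ** f)^# ** (b ** f)) x.
  rewrite gconv_weight; last first.
    by move=> y yx; rewrite /w /t /S /gconv grange_divl.
  have -> : (b ** f)^# = f^# ** b^# by apply/funext => y; exact: ginvol_gconv.
  rewrite gconvA; [|exact: finC (ginvolC fC)|exact: finC].
  have -> : b^# ** (b ** f) = fun y => S y * f y.
    apply/funext => y; rewrite -(gconv_source_injective _ _ _ b'inj).
    by rewrite ginvolK; congr gconv; apply/funext => z; rewrite mul1r.
  have := gconvPr 1 (fun y => `|w y| ^+ 2 * f y) (fun y => S y * f y) x (finC (ginvolC fC)).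
  rewrite mul1r => <-; rewrite -gconvZr; congr gconv; apply/funext => y.
  by rewrite mul1r normc_sqrt// tE; ring.
have C1 := gconvC (ginvolC fC) fC.
have C2 := gconvC (ginvolC f'C) f'C.
have C3 := gconvC (ginvolC bfC) bfC.
have C4 := induced_ge0 f'C.
rewrite -(inducedZ _ C1) (funext key) (inducedD C2 C3).
by rewrite lerDr.
Qed.

End InducedFunctional.

(** * The induced representation *)

Section CcSpace.
Variables (R : realType) (X : topologicalType).

Definition Cc_pred : {pred (X -> R[i]^o)} := mem (@Cc R X : set (X -> R[i]^o)).

Lemma Cc_submod_closed : GRing.submod_closed Cc_pred.
Proof.
split; first by apply/mem_set; exact: Cc0.
by move=> a u v /set_mem uC /set_mem vC; apply/mem_set; exact: Cc_linear.
Qed.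

HB.instance Definition _ :=
  GRing.isSubmodClosed.Build _ _ Cc_pred Cc_submod_closed.

Record Cc_space := CcSpace { Cc_val :> X -> R[i]^o; Cc_valP : Cc_val \in Cc_pred }.

HB.instance Definition _ := [isSub for Cc_val].
HB.instance Definition _ := [Choice of Cc_space by <:].
HB.instance Definition _ := [SubChoice_isSubLmodule of Cc_space by <:].

Definition Cc_mk (f : X -> R[i]) (fC : Cc f) : Cc_space := CcSpace (mem_set fC).

Lemma Cc_space_Cc (f : Cc_space) : Cc (f : X -> R[i]).
Proof. exact: set_mem (Cc_valP f). Qed.

Lemma Cc_spaceD a (f h : Cc_space) x : (a *: f + h) x = a * f x + h x.
Proof. by []. Qed.

Lemma Cc_space_inj (f h : Cc_space) : (forall x, f x = h x) -> f = h.
Proof. by move=> e; apply: val_inj; apply/funext. Qed.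

End CcSpace.

Section InducedRepresentation.
Variables (R : realType) (Q : topologicalType) (g : groupoid Q).
Hypothesis hQ : topological_groupoid g.
Hypothesis hlc : locally_compact [set: Q].
Hypothesis hT2 : hausdorff_space Q.
Hypothesis hr : r_discrete g.
Variables (G : groupType) (c : Q -> G) (hc : groupoid_hom g c).
Hypothesis hcont : continuous (c : Q -> discrete_topology G).
Variables (H : hilbertSpace R) (rho : (ghom_ker c -> R[i]) -> H -> H).
Hypothesis hrho : Cc_rep (kernel_groupoid hc) rho.
Variable xi : H.
Implicit Types (f h v : Cc_space R Q) (b k : Q -> R[i]).

Local Notation "f ** h" := (gconv g f h) (at level 40, left associativity).
Local Notation "f ^#" := (ginvol g f) (at level 2, format "f ^#").
Local Notation chi := (@ker_indic R Q G c).
Local Notation res := (@ker_restrict R Q G c).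
Local Notation gconvC := (gconv_Cc hQ hlc hT2 hr).
Local Notation ginvolC := (ginvol_Cc hQ hT2).
Local Notation finC := (Cc_fiber_finite hQ hlc hT2 hr).
Local Notation ind := (induced_state rho xi).

Definition induced_form f h : R[i] := ind (h^# ** f).

Lemma induced_form_linear a f h v :
  induced_form (a *: f + h) v = a * induced_form f v + induced_form h v.
Proof.
have vC := ginvolC (Cc_space_Cc v).
have fC := gconvC vC (Cc_space_Cc f); have hC := gconvC vC (Cc_space_Cc h).
rewrite /induced_form -(induced_linear hcont hrho xi a fC hC); congr induced_state.
by apply/funext => x; rewrite -(gconvPr a f h x (finC vC)).
Qed.

Lemma induced_form_conj f h : induced_form h f = (induced_form f h)^*.
Proof.
have C1 := gconvC (ginvolC (Cc_space_Cc h)) (Cc_space_Cc f).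
rewrite /induced_form -(induced_ginvol hcont hrho xi C1); congr induced_state.
by apply/funext => x; rewrite ginvol_gconv ginvolK.
Qed.

Lemma induced_form_ge0 f : 0 <= induced_form f f.
Proof. exact: (induced_ge0 hQ hlc hT2 hr hcont hrho xi (Cc_space_Cc f)). Qed.

Definition induced_inner :=
  SemiInner induced_form_linear induced_form_conj induced_form_ge0.

Local Notation S := induced_inner.

(** The default [f] makes the operation total; it is only meaningful for [b] in [Cc]. *)
Definition lmul b f : Cc_space R Q := insubd f (b ** f).

Lemma lmulE b f x : Cc b -> lmul b f x = (b ** f) x.
Proof.
move=> bC; rewrite /lmul -[X in X x]/(val _) insubdK//.
by apply/mem_set; exact: gconvC bC (Cc_space_Cc f).
Qed.

Lemma lmul_fun b f : Cc b -> (lmul b f : Q -> R[i]) = b ** f.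
Proof. by move=> bC; apply/funext => x; exact: lmulE. Qed.

Lemma lmul_linear b : Cc b -> linear (lmul b).
Proof.
move=> bC a f h; apply: Cc_space_inj => x; rewrite Cc_spaceD !lmulE//.
exact: (gconvPr a f h x (finC bC)).
Qed.

Lemma lmul_adj b : Cc b -> forall f h, S (lmul b f) h = S f (lmul b^# h).
Proof.
move=> bC f h; rewrite /= /induced_form (lmul_fun f bC) (lmul_fun h (ginvolC bC)).
congr induced_state; apply/funext => x.
have -> : (b^# ** h)^# = h^# ** b.
  by apply/funext => y; rewrite ginvol_gconv ginvolK.
by rewrite gconvA//; [exact: finC (ginvolC (Cc_space_Cc h))|exact: finC].
Qed.

Lemma lmulP a b k f : Cc b -> Cc k ->
  lmul (fun x => a * b x + k x) f = a *: lmul b f + lmul k f.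
Proof.
move=> bC kC; apply: Cc_space_inj => x; rewrite Cc_spaceD !lmulE//.
  exact: gconvPl (finC bC) (finC kC).
exact: Cc_linear.
Qed.

Lemma lmulM b k f : Cc b -> Cc k -> lmul (b ** k) f = lmul b (lmul k f).
Proof.
move=> bC kC; apply: Cc_space_inj => x.
rewrite (lmulE _ _ (gconvC bC kC)) (lmulE _ _ bC) (lmul_fun _ kC).
exact: gconvA (finC bC) (finC kC).
Qed.

(** On a bisection the supremum of the modulus of [b] bounds left multiplication; sums of such
    functions follow by the triangle inequality. *)
Lemma lmul_bounded b : Cc b ->
  exists2 M : R[i], 0 <= M & forall f, snorm S (lmul b f) <= M * snorm S f.
Proof.
move: b; apply: (Cc_ind hlc hT2 (bisection_ex hQ hr)).
- exists 0 => // f; rewrite mul0r.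
  have -> : lmul (fun=> 0) f = 0.
    apply: Cc_space_inj => x; rewrite lmulE; last exact: Cc0.
    by rewrite /gconv fsbig1// => y _; rewrite mul0r.
  by rewrite /snorm sdot0l sqrtC0.
- move=> b k bC kC [M M0 bM] [M' M'0 kM]; exists (M + M'); first exact: addr_ge0.
  move=> f; have -> : lmul (fun x => b x + k x) f = lmul b f + lmul k f.
    rewrite -(scale1r (lmul b f)) -(lmulP 1 f bC kC).
    by under [in RHS]eq_fun do rewrite mul1r.
  by rewrite (le_trans (snormD _ _ _))// mulrDl lerD.
move=> b U bC BU bU; have [M M0 bM] := Cc_bounded bC; exists M => // f.
rewrite -(ler_pXn2r (ltn0Sn 1)) ?nnegrE ?mulr_ge0 ?snorm_ge0//.
rewrite exprMn !snormK /= /induced_form (lmul_fun f bC).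
apply: (induced_gconv_le hQ hlc hT2 hr hcont hrho xi bC BU) => //.
  by move=> x bx; apply/bU/Cc_supp.
exact: Cc_space_Cc.
Qed.

Definition induced_space := hilbert_completion S.

(** Vectors are antilinear functionals, so [b] acts by precomposition with multiplication by [b^#];
    on embedded functions this is multiplication by [b]. *)
Definition induced_rep b (F : induced_space) : induced_space :=
  completion_op (lmul b^#) F.

Lemma induced_repE b (F : completion S) v : Cc b ->
  (induced_rep b F : completion S) v = F (lmul b^# v).
Proof.
move=> bC; have [M M0 bM] := lmul_bounded (ginvolC bC).
exact: (completion_opE (lmul_linear (ginvolC bC)) (lmul_adj bC) M0 bM).
Qed.

Lemma induced_Cc_rep : Cc_rep g induced_rep.
Proof.
split.
- move=> b bC; have b'C := ginvolC bC; have [M M0 bM] := lmul_bounded b'C.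
  split; first exact: (completion_op_linear (lmul_linear b'C) (lmul_adj bC) M0 bM).
  by exists M; exact: (completion_op_norm (lmul_linear b'C) (lmul_adj bC) M0 bM).
- move=> a b k bC kC F; apply: cfun_inj => v.
  have lC := Cc_linear a bC kC.
  rewrite (induced_repE _ _ lC) cfunD !induced_repE//.
  (* The adjoint is antilinear and vectors are antilinear functionals; the two conjugations
     cancel. *)
  have -> : ginvol g (fun x => a * b x + k x) = fun x => a^* * b^# x + k^# x.
    exact: ginvol_fun_linear.
  rewrite lmulP; [|exact: ginvolC|exact: ginvolC].
  by rewrite cfun_linear conjCK.
- move=> b k bC kC F; apply: cfun_inj => v.
  rewrite (induced_repE _ _ (gconvC bC kC)) !induced_repE//.
  have -> : (b ** k)^# = k^# ** b^# by apply/funext => x; exact: ginvol_gconv.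
  by rewrite lmulM//; exact: ginvolC.
move=> b bC F F'; have b'C := ginvolC bC.
have [M M0 bM] := lmul_bounded b'C; have [M' M'0 bM'] := lmul_bounded bC.
rewrite /induced_rep ginvolK.
exact: (completion_op_adj _ _ (lmul_linear bC) (lmul_linear b'C) (lmul_adj bC) M0 M'0 bM' bM).
Qed.

Lemma induced_rep_embed b f : Cc b ->
  induced_rep b (embed S f) = embed S (lmul b f).
Proof.
move=> bC; apply: cfun_inj => v; rewrite induced_repE//= -/(induced_form _ _).
by have := lmul_adj bC f v => /= ->.
Qed.

(** When [f] is supported in the kernel, so is [f^#], and the form at [f] is the expression in
    [induced_square]. *)
Lemma embed_norm f : (forall x, chi x * f x = f x) ->
  `|embed S f| = `|rho (res f) xi|.
Proof.
move=> ff; have fC := Cc_space_Cc f.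
have e : (fun x => chi x * f^# x) = f^#.
  apply/funext => x; rewrite /ginvol -ff rmorphM mulrA /=; congr (_ * _).
  rewrite /ker_indic (ghom_inv hc) invg_eq1 conjC_nat.
  by case: (_ == _); rewrite ?mul1r ?mul0r.
have := induced_square hQ hT2 hcont hrho xi fC; rewrite e => sq.
apply/eqP; rewrite -(@eqrXn2 _ 2)//; apply/eqP.
by rewrite cdot_normE cdot_embed -sq.
Qed.

End InducedRepresentation.

(** * Comparison of the universal norms and injectivity *)

Section Hilbert.
Variables (R : realType) (H : hilbertSpace R).

Lemma hilbert_CauchySchwarz (u v : H) : `|hs_dot H u v| <= `|u| * `|v|.
Proof.
have P a x y z : hs_dot H (a *: x + y) z = a * hs_dot H x z + hs_dot H y z.
  exact: linearPl.
have Cj x y : hs_dot H y x = (hs_dot H x y)^*.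
  by rewrite hermC expr0 mul1r.
have ge0 x : 0 <= hs_dot H x x by rewrite -hs_norm exprn_ge0.
have := sdot_CauchySchwarz (SemiInner P Cj ge0) u v.
by rewrite /snorm /= -!hs_norm !sqrCK.
Qed.

End Hilbert.

Section UniversalNorm.
Variables (R : realType) (Q : topologicalType) (g : groupoid Q).
Variable A : groupoidCStar R g.

Lemma gcs_rep_le (H : hilbertSpace R) (rho : (Q -> R[i]) -> H -> H) f (xi : H) :
  Cc_rep g rho -> Cc f -> `|rho f xi| <= `|gcs_inj A f| * `|xi|.
Proof.
move=> hrho fC; have [hlin _ _ _] := hrho; have [lf _] := hlin f fC.
have rho0 : rho f 0 = 0.
  by have := lf (-1) 0 0; rewrite scaler0 addr0 scaleN1r addNr.
have rhoZ a z : rho f (a *: z) = a *: rho f z.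
  by have := lf a z 0; rewrite addr0 rho0 addr0.
have [/normr0_eq0 ->|x0] := eqVneq `|xi| 0; first by rewrite rho0 !normr0 mulr0.
have xgt0 : 0 < `|xi| by rewrite lt_def x0 normr_ge0.
have e : xi = `|xi| *: (`|xi|^-1 *: xi) by rewrite scalerA divff// scale1r.
rewrite {1}e rhoZ normrZ normr_id mulrC ler_pM2r//.
have [ub _] := gcs_norm A fC; apply: ub.
exists H, rho, (`|xi|^-1 *: xi); split => //.
by rewrite normrZ normfV normr_id mulVf.
Qed.

Lemma gcs_norm_le f (M : R[i]) : Cc f ->
  (forall (H : hilbertSpace R) (rho : (Q -> R[i]) -> H -> H) (xi : H),
     Cc_rep g rho -> `|xi| <= 1 -> `|rho f xi| <= M) -> `|gcs_inj A f| <= M.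
Proof.
move=> fC h; have [_ lb] := gcs_norm A fC; apply: lb.
by move=> _ [H [rho [xi [hrho xi1 ->]]]]; exact: h.
Qed.

End UniversalNorm.

Section Faithful.
Variables (R : realType) (Q : topologicalType) (g : groupoid Q).
Hypothesis hQ : topological_groupoid g.
Hypothesis hlc : locally_compact [set: Q].
Hypothesis hT2 : hausdorff_space Q.
Hypothesis hr : r_discrete g.
Variables (G : groupType) (c : Q -> G) (hc : groupoid_hom g c).
Hypothesis hcont : continuous (c : Q -> discrete_topology G).
Variable CQ : groupoidCStar R g.
Local Notation gN := (kernel_groupoid hc).
Implicit Types a e : ghom_ker c -> R[i].

(** The universal bound for C_c(Q) is applied to the induced representation at the embedded
    extension of [e]; [embed_norm] evaluates both norms. *)
Lemma rep_square_le (H : hilbertSpace R) (rho : (ghom_ker c -> R[i]) -> H -> H)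
    (xi : H) a e : Cc_rep gN rho -> Cc a -> Cc e ->
  `|rho a (rho e xi)| <= `|gcs_inj CQ (extend0 a)| * `|rho e xi|.
Proof.
move=> hrho aC eC.
have aC' := extend0_Cc hT2 hcont aC; have eC' := extend0_Cc hT2 hcont eC.
have ka := ker_indic_extend0 a; have ke := ker_indic_extend0 e.
have irep := induced_Cc_rep hQ hlc hT2 hr hcont hrho xi.
pose S := induced_inner hQ hlc hT2 hr hcont hrho xi.
have hE := embed_norm hQ hlc hT2 hr hcont hrho xi.
have n1 : `|embed S (Cc_mk eC')| = `|rho e xi|.
  by rewrite hE /= ?extend0K// => x; exact: (congr1 (fun f => f x) ke).
have := @gcs_rep_le _ _ _ CQ (induced_space hQ hlc hT2 hr hcont hrho xi) _ _
  (embed S (Cc_mk eC')) irep aC'.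
rewrite (induced_rep_embed hQ hlc hT2 hr hcont hrho xi _ aC') -/S n1.
rewrite hE; last first.
  (* A product of two functions supported in the kernel is supported in the kernel. *)
  move=> x; rewrite (lmul_fun hQ hlc hT2 hr _ aC') /ker_indic.
  case: (eqVneq (c x) 1%g) => [_|cx]; first by rewrite mul1r.
  rewrite mul0r /gconv fsbig1// => y yx.
  have [cy|cy] := eqVneq (c y) 1%g; last by rewrite extend0_out// mul0r.
  by rewrite [X in _ * X]extend0_out ?mulr0// (ghom_div hc)// cy invg1 mul1g.
rewrite (lmul_fun hQ hlc hT2 hr _ aC') /= -{1}ka.
rewrite -(ker_restrict_gconv hc) !extend0K.
by have [_ _ rm _] := hrho; rewrite rm.
Qed.

Lemma gcs_norm_ker_le (CN : groupoidCStar R gN) a : Cc a ->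
  `|gcs_inj CN a| <= `|gcs_inj CQ (extend0 a)|.
Proof.
move=> aC; set m := `|gcs_inj CQ _|; apply: gcs_norm_le => // H rho xi hrho xi1.
have [hlin _ _ ra] := hrho.
have a'C : Cc (ginvol gN a).
  rewrite -(extend0K a) ker_restrict_ginvol; apply: (ker_restrict_Cc hcont).
  exact: (ginvol_Cc hQ hT2 (extend0_Cc hT2 hcont aC)).
have m0 : 0 <= m by exact: normr_ge0.
(* Both bounds below arise from Cauchy-Schwarz as estimates of a square, from which one factor [t]
   is cancelled. *)
have cancel (t n : R[i]) : 0 <= t -> 0 <= n -> t ^+ 2 <= m * t * n -> t <= m * n.
  move=> t0 n0; have [->|tn0] := eqVneq t 0; first by rewrite mulr_ge0.
  by rewrite mulrAC expr2 ler_pM2r// lt_def tn0.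
(* Taking e = a^* bounds the adjoint of rho a, hence rho a itself. *)
have star_le z : `|rho (ginvol gN a) z| <= m * `|z|.
  apply: cancel => //; rewrite hs_norm ra//.
  rewrite -[leLHS]ger0_norm; last by rewrite -ra// -hs_norm exprn_ge0.
  rewrite (le_trans (hilbert_CauchySchwarz _ _))// mulrC ler_wpM2r//.
  exact: rep_square_le.
have : `|rho a xi| <= m * `|xi|.
  apply: cancel => //; rewrite hs_norm -ra//.
  rewrite -[leLHS]ger0_norm; last by rewrite ra// -hs_norm exprn_ge0.
  rewrite (le_trans (hilbert_CauchySchwarz _ _))// ler_wpM2r//.
by move=> h; rewrite (le_trans h)// ler_piMr.
Qed.

End Faithful.

Theorem lemma5p8 (R : realType) (Q : topologicalType) (g : groupoid Q)
    (hQ : topological_groupoid g)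
    (hlc : locally_compact [set: Q]%classic)
    (hT2 : hausdorff_space Q)
    (hr : r_discrete g)
    (G : groupType) (c : Q -> G)
    (hc : groupoid_hom g c)
    (hcont : continuous (c : Q -> discrete_topology G))
    (hA : topologically_amenable R g)
    (CN : groupoidCStar R (kernel_groupoid hc))
    (CQ : groupoidCStar R g)
    (i : CN -> CQ)
    (hi : canonical_map i) :
  injective i.
Proof.
have [[ilin _ _] icont iE] := hi.
have i0 z : i z = 0 -> z = 0.
  move=> iz; apply/eqP; rewrite -normr_le0.
  (* One [e] is the distance from [z] to an element of the dense image of C_c(N); the other bounds
     the norm of that element, which is at most the norm of its image under [i], within [e] of
     [i z = 0]. *)
  apply: (@le_lim0 _ _ _ 2) => // e e0; rewrite add0r.
  pose U := [set y : CN | `|z - y| < e /\ `|i z - i y| < e].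
  have near_z : nbhs z U.
    apply: filterI.
      by move: (nbhsx_ballx z e e0); rewrite -ball_normE.
    have := icont z _ (nbhsx_ballx (i z) e e0); by rewrite -ball_normE.
  have [y [Uy [f fC fy]]] :=
    @gcs_dense _ _ _ CN U° (ex_intro _ z near_z) (@open_interior _ U).
  rewrite -{y}fy in Uy; have [/= h1 h2] := interior_subset Uy.
  rewrite -(subrK (gcs_inj CN f) z) (le_trans (ler_normD _ _))// mulr_natl mulr2n.
  rewrite lerD ?(ltW h1)//.
  rewrite (le_trans (gcs_norm_ker_le hQ hlc hT2 hr hcont CQ CN fC))// -iE//.
  by move: h2; rewrite iz sub0r normrN => /ltW.
move=> x y xy; apply/eqP; rewrite -subr_eq0; apply/eqP; apply: i0.
have -> : x - y = (-1) *: y + x by rewrite scaleN1r addrC.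
by rewrite ilin scaleN1r xy addNr.
Qed.
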